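(* Let $\Omega$ be a bounded open set in $\mathbb{R}^n$, $n\ge 3$. Then there exist infinitely many Dirichlet eigenvalues $\{\lambda_{k_j}\}_{j\in\mathbb{N}}$ satisfying Pólya's conjecture, i.e., $$\frac{|\Omega|\,\omega(n)}{(2\pi)^{n}}\,\lambda_{k_j}^{\frac n2}\ge k_j .$$
   Context: $\Omega$ is a nonempty bounded open subset of $\mathbb{R}^n$, $|\Omega|$ is its Lebesgue measure, $\omega(n)$ is the volume of the unit ball of $\mathbb{R}^n$. $0<\lambda_1\le\lambda_2\le\lambda_3\le\cdots$ are the eigenvalues, counted with multiplicity, of the Dirichlet Laplacian $-\Delta$ on $\Omega$. *)

(* Defs.v *)
From HB Require Import structures.
From mathcomp Require Import all_boot all_order all_algebra.
From mathcomp Require Import all_classical all_reals all_analysis.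

Set Implicit Arguments.
Unset Strict Implicit.
Unset Printing Implicit Defensive.

Import Order.TTheory GRing.Theory Num.Theory.
Import numFieldNormedType.Exports.

Local Open Scope classical_set_scope.
Local Open Scope ring_scope.

(* R^n is 'rV[R]_n.  The library norm on 'rV[R]_n is the sup norm: it gives the
   usual open and bounded sets, but not the Euclidean unit ball (see [unit_ball]).
   Its sigma-algebra is generated by the coordinates, i.e. it is the Borel one. *)

Definition measure_rV_display : measure_display -> measure_display.
Proof. exact. Qed.

Section measurable_rV.
Context {R : realType} (n : nat).

Let coords : 'I_n -> 'rV[R]_n -> measurableTypeR R := fun i x => x ord0 i.

Let rV_set0 : g_sigma_preimage coords set0.
Proof. exact: sigma_algebra0. Qed.

Let rV_setC A : g_sigma_preimage coords A -> g_sigma_preimage coords (~` A).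
Proof. exact: sigma_algebraC. Qed.

Let rV_bigcup (F : _^nat) : (forall i, g_sigma_preimage coords (F i)) ->
  g_sigma_preimage coords (\bigcup_i (F i)).
Proof. exact: sigma_algebra_bigcup. Qed.

HB.instance Definition _ := @isMeasurable.Build
  (measure_rV_display default_measure_display)
  'rV[R]_n (g_sigma_preimage coords) rV_set0 rV_setC rV_bigcup.

Lemma measurable_coord (i : 'I_n) :
  measurable_fun [set: 'rV[R]_n] (fun x : 'rV[R]_n => x ord0 i).
Proof.
move=> _ Y mY; rewrite setTI; apply: sub_sigma_algebra => /=.
rewrite -bigcup_seq/=; exists i => /=; first by rewrite mem_index_enum.
by exists Y => //; rewrite setTI.
Qed.

Lemma measurable_fun_coordP d (T : measurableType d) (f : T -> 'rV[R]_n) :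
  (forall i, measurable_fun [set: T] (fun t => f t ord0 i)) ->
  measurable_fun [set: T] f.
Proof.
move=> mf _ A mA; rewrite setTI; move: A mA.
suff : g_sigma_preimage coords `<=` [set A | measurable (f @^-1` A)] by [].
apply: smallest_sub => /=.
  split => /=.
  - by rewrite preimage_set0.
  - by move=> A mA; rewrite setTD preimage_setC; exact: measurableC.
  - by move=> F mF; rewrite preimage_bigcup; exact: bigcup_measurable.
move=> A; rewrite -bigcup_seq => -[i _ [B mB <-]].
rewrite /= setTI -comp_preimage -[X in measurable X]setTI.
exact: (mf i).
Qed.

End measurable_rV.

Section lebesgue_measure_rV.
Context {R : realType}.

Definition rV_cons n (p : measurableTypeR R * 'rV[R]_n) : 'rV[R]_n.+1 :=
  \row_i oapp (p.2 ord0) p.1 (unlift ord0 i).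

Definition rV_uncons n (v : 'rV[R]_n.+1) : measurableTypeR R * 'rV[R]_n :=
  (v ord0 ord0, \row_i v ord0 (lift ord0 i)).

Lemma rV_consK n : cancel (@rV_cons n) (@rV_uncons n).
Proof.
case=> x v; rewrite /rV_cons /rV_uncons/= mxE unlift_none/=; congr (_, _).
by apply/rowP => i; rewrite !mxE liftK.
Qed.

Lemma measurable_rV_cons n : measurable_fun [set: measurableTypeR R * 'rV[R]_n] (@rV_cons n).
Proof.
apply: measurable_fun_coordP => i.
case: (unliftP ord0 i) => [j|] ->.
  rewrite (_ : (fun _ => _) = (fun v : 'rV[R]_n => v ord0 j) \o snd).
    exact: measurableT_comp (measurable_coord j) measurable_snd.
  by apply/funext => -[x v] /=; rewrite mxE liftK.
rewrite (_ : (fun _ => _) = fst); first exact: measurable_fst.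
by apply/funext => -[x v] /=; rewrite mxE unlift_none.
Qed.

Lemma measurable_rV_uncons n : measurable_fun [set: 'rV[R]_n.+1] (@rV_uncons n).
Proof.
apply: measurable_fun_pair; first exact: measurable_coord.
apply: measurable_fun_coordP => i.
rewrite (_ : (fun _ => _) = fun v : 'rV[R]_n.+1 => v ord0 (lift ord0 i)).
  exact: measurable_coord.
by apply/funext => v; rewrite mxE.
Qed.

Section step.
Variables (n : nat) (m : {sigma_finite_measure set 'rV[R]_n -> \bar R}).

Definition lebesgue_step : set 'rV[R]_n.+1 -> \bar R :=
  pushforward (@lebesgue_measure R \x m)%E (@rV_cons n).

HB.instance Definition _ := Measure.copy lebesgue_step
  (measure_function_pushforward__canonical__measure_function_Measure
    (@lebesgue_measure R \x m : {measure set _ -> \bar R})%E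
    (@measurable_rV_cons n)).

Lemma lebesgue_step_sigma_finite : sigma_finite setT lebesgue_step.
Proof.
have /sigma_finiteP[F [TF ndF Foo]] := sigma_finiteT (@lebesgue_measure R).
have /sigma_finiteP[G [TG ndG Goo]] := sigma_finiteT m.
exists (fun k => @rV_uncons n @^-1` (F k `*` G k)).
  apply/seteqP; split => // v _.
  have [i _ Fi] : (\bigcup_i F i) (rV_uncons v).1 by rewrite -TF.
  have [j _ Gj] : (\bigcup_i G i) (rV_uncons v).2 by rewrite -TG.
  exists (maxn i j) => //; split => /=.
  - by move: Fi; exact/subsetPset/ndF/leq_maxl.
  - by move: Gj; exact/subsetPset/ndG/leq_maxr.
move=> k; have [mF Fk] := Foo k; have [mG Gk] := Goo k; split.
  rewrite -[X in measurable X]setTI.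
  by apply: measurable_rV_uncons => //; exact: measurableX.
rewrite /lebesgue_step /pushforward -comp_preimage.
rewrite (_ : _ \o _ = id) ?preimage_id; last first.
  by apply/funext => p; exact: rV_consK.
by rewrite product_measure1E// lte_mul_pinfty// ge0_fin_numE.
Qed.

HB.instance Definition _ := Measure_isSigmaFinite.Build _ _ _
  lebesgue_step lebesgue_step_sigma_finite.

End step.

(* n-dimensional Lebesgue measure, as an iterated product measure *)
Fixpoint lebesgue_rV (n : nat) : {sigma_finite_measure set 'rV[R]_n -> \bar R} :=
  match n with
  | 0 => \d_(0 : 'rV[R]_0)
  | n'.+1 => lebesgue_step (lebesgue_rV n')
  end.

End lebesgue_measure_rV.

Section dirichlet.
Context {R : realType} (n : nat).
Local Notation E := 'rV[R]_n.
Local Notation mu := (@lebesgue_rV R n).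
Implicit Types (Omega : set E) (u v f phi : E -> R) (g h : 'I_n -> E -> R).

Definition unit_ball : set E := [set x | \sum_i x ord0 i ^+ 2 < 1].

Definition partial (i : 'I_n) f : E -> R := 'D_(delta_mx ord0 i) f.

Fixpoint Ck (k : nat) f : Prop :=
  match k with
  | 0 => continuous f
  | k'.+1 => continuous f /\
      forall i, (forall x, derivable f x (delta_mx ord0 i)) /\ Ck k' (partial i f)
  end.

(* C_c^oo(Omega), each function being extended by 0 to R^n *)
Definition test_fun Omega phi : Prop :=
  [/\ forall k, Ck k phi,
      compact (closure [set x | phi x != 0]) &
      closure [set x | phi x != 0] `<=` Omega].

(* Functions on Omega are the restrictions to Omega of functions on R^n; their
   values outside Omega are irrelevant below ([u \_ Omega] is u on Omega and 0
   elsewhere). *)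
Definition L2 Omega u : Prop := u \_ Omega \in Lfun mu 2%:E.

Definition L2_cvg Omega (phi_ : nat -> E -> R) u : Prop :=
  'N[mu]_2%:E[EFin \o ((phi_ m \- u) \_ Omega)%R]%E @[m --> \oo] --> 0%E.

Definition inner Omega u v : R := \int[mu]_(x in Omega) (u x * v x).

Definition weak_gradient Omega u g : Prop :=
  forall phi i, test_fun Omega phi ->
    inner Omega u (partial i phi) = - inner Omega (g i) phi.

Definition sobolev_H1 Omega u g : Prop :=
  [/\ L2 Omega u, forall i, L2 Omega (g i) & weak_gradient Omega u g].

(* [sobolev_H10 Omega u g]: u is in H^1_0(Omega), the closure of C_c^oo(Omega) in
   H^1(Omega), and g is its weak gradient. *)
Definition sobolev_H10 Omega u g : Prop :=
  sobolev_H1 Omega u g /\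
  exists phi_ : nat -> E -> R,
    [/\ forall m, test_fun Omega (phi_ m),
        L2_cvg Omega phi_ u &
        forall i, L2_cvg Omega (fun m => partial i (phi_ m)) (g i)].

(* The graph of -Delta, the operator associated with the Dirichlet form
   (u, v) |-> \int_Omega grad u . grad v of domain H^1_0(Omega) *)
Definition dirichlet_laplacian Omega u f : Prop :=
  L2 Omega f /\
  exists2 g, sobolev_H10 Omega u g &
    forall v h, sobolev_H10 Omega v h ->
      \sum_i inner Omega (g i) (h i) = inner Omega f v.

Definition eigenspace Omega (lambda : R) : set (E -> R) :=
  [set u | dirichlet_laplacian Omega u (lambda \*o u)].

Definition ae_eq_on Omega u v : Prop := {ae mu, forall x, Omega x -> u x = v x}.

(* The space V of functions on Omega has dimension m modulo a.e. equality. *)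
Definition has_dim Omega (V : set (E -> R)) (m : nat) : Prop :=
  exists e : 'I_m -> E -> R,
    [/\ forall j, V (e j),
        forall c : 'I_m -> R,
          ae_eq_on Omega (fun x => \sum_j c j * e j x) (fun=> 0) ->
          forall j, c j = 0 &
        forall u, V u ->
          exists c : 'I_m -> R, ae_eq_on Omega u (fun x => \sum_j c j * e j x)].

(* lambda 0 <= lambda 1 <= ... lists the eigenvalues of the Dirichlet Laplacian,
   each of them as many times as the dimension of its eigenspace; a real number
   which is not an eigenvalue has eigenspace {0} and does not occur. *)
Definition dirichlet_eigenvalues Omega (lambda : nat -> R) : Prop :=
  {homo lambda : i j / (i <= j)%N >-> i <= j} /\
  forall t : R, exists s : seq nat,
    [/\ uniq s, forall k, (k \in s) = (lambda k == t) &
        has_dim Omega (eigenspace Omega t) (size s)].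

End dirichlet.

(* Main.v *)
Require Import Defs.
From mathcomp Require Import all_boot all_order all_algebra.
From mathcomp Require Import all_classical all_reals all_analysis.
From mathcomp Require Import measurable_realfun.
From mathcomp Require Import ring lra.

(** Let [r k] be the radius of the ball of frequencies for which Weyl's
    semiclassical eigenvalue count is [k]. Polya's inequality for the
    eigenvalue of rank [k] says that this eigenvalue is at least [r k ^+ 2].
    If it fails from some rank on, then the sum over [j <= k] of
    [r k ^+ 2 - lambda_j] exceeds the sum of [r k ^+ 2 - r j ^+ 2], up to a
    constant. The contradiction comes from Melas' improvement of the
    Berezin-Li-Yau inequality, which bounds the first sum from above.

    Take orthonormal eigenfunctions ([orthonormal_eigenfunctions]) and let [F]
    be the sum of the squared moduli of their Fourier transforms. By Bessel's
    inequality [F] is at most the measure of [Omega] ([density_le]). By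
    Plancherel, [(2 pi)^n] times the sum of [z - lambda_j] is at most the
    integral of [(z - |xi|^2) * F(xi)] ([sobolev_energy]). Under the
    constraint on [F] this integral is maximal when [F] is the measure of
    [Omega] on the ball [|xi|^2 < z] and 0 elsewhere. Since [Omega] is bounded,
    however, [F] varies slowly ([density_slow]) and cannot jump across the
    sphere; for [z = r k ^+ 2] this costs at least [c * r k ^+ n]
    ([bathtub_gain]). Cutting the ball into the layers between consecutive
    radii [r j], each of which counts for one eigenvalue, shows that the
    extremal value exceeds the sum of [r k ^+ 2 - r j ^+ 2] by at most
    [r k ^+ 2] ([Rintegral_ball_layers], [weyl_layers]). Altogether
    [c * r k ^+ n <= r k ^+ 2 + constant] up to a factor, which is false for
    large [k] as soon as [n >= 3].

    The Fourier input is needed only in the form: for a test function, the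
    integral of [(z - |xi|^2)] against its squared Fourier transform over a
    large ball is at least [(2 pi)^n * (z * |phi|^2 - |grad phi|^2)]
    ([energy_inequality]). It is obtained by sampling on a lattice of mesh [h].
    Parseval's identity is then the orthogonality of finitely many exponentials
    on the dual cell ([Rintegral_spectrum]), and difference quotients act as
    multipliers ([spectrum_diff]). The multiplier exceeds [z] off a ball that
    does not depend on [h], so that the rest of the dual cell can be dropped
    and dominated convergence applies as [h] tends to 0. *)

Set Implicit Arguments.
Unset Strict Implicit.
Unset Printing Implicit Defensive.

Import Order.TTheory GRing.Theory Num.Theory.
Import numFieldNormedType.Exports.

Local Open Scope classical_set_scope.
Local Open Scope ring_scope.

(** * Real-valued integrals *)

Section real_integrals.
Context d (T : measurableType d) (R : realType).
Variables (mu : {measure set T -> \bar R}) (D : set T).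
Hypothesis mD : measurable D.

Lemma integrable_sumR (I : Type) (s : seq I) (f : I -> T -> R) :
  (forall i, mu.-integrable D (EFin \o f i)) ->
  mu.-integrable D (EFin \o (fun x => \sum_(i <- s) f i x)).
Proof.
move=> fi; rewrite (_ : EFin \o _ = fun x => (\sum_(i <- s) (f i x)%:E)%E).
  exact: (@integrable_sum _ _ _ mu _ mD _ s xpredT (fun i x => (f i x)%:E) (fun i _ => fi i)).
by apply/funext => x /=; rewrite sumEFin.
Qed.

Lemma integrableZR (c : R) (f : T -> R) : mu.-integrable D (EFin \o f) ->
  mu.-integrable D (EFin \o (fun x => c * f x)).
Proof.
move=> fi; rewrite (_ : EFin \o _ = fun x => (c%:E * (EFin \o f) x)%E).
  exact: integrableZl.
by apply/funext => x /=; rewrite EFinM.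
Qed.

Lemma integrableDR (f g : T -> R) : mu.-integrable D (EFin \o f) ->
  mu.-integrable D (EFin \o g) -> mu.-integrable D (EFin \o (fun x => f x + g x)).
Proof.
by move=> fi gi; rewrite (_ : EFin \o _ = (EFin \o f) \+ (EFin \o g))%E; [exact: integrableD|].
Qed.

Lemma Rintegral_sum (I : Type) (s : seq I) (f : I -> T -> R) :
  (forall i, mu.-integrable D (EFin \o f i)) ->
  \int[mu]_(x in D) (\sum_(i <- s) f i x) = \sum_(i <- s) \int[mu]_(x in D) f i x.
Proof.
move=> fi; elim: s => [|i s IH].
  under eq_Rintegral do rewrite big_nil.
  by rewrite big_nil /Rintegral /= integral0.
under eq_Rintegral do rewrite big_cons.
rewrite RintegralD//; last exact: integrable_sumR.
by rewrite IH big_cons.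
Qed.

Hypothesis Doo : (mu D < +oo)%E.

Lemma bounded_fun_integrable (f : T -> R) (C : R) : measurable_fun D f ->
  (forall x, D x -> `|f x| <= C) -> mu.-integrable D (EFin \o f).
Proof.
move=> mf fC; apply: measurable_bounded_integrable => //.
exists C; split; first by rewrite num_real.
by move=> y Cy x Dx; exact: le_trans (fC x Dx) (ltW Cy).
Qed.

Lemma bounded_cvg_Rintegral (f_ : nat -> T -> R) (f : T -> R) (C : R) :
  (forall m, measurable_fun D (f_ m)) ->
  (forall m x, D x -> `|f_ m x| <= C) ->
  (forall x, D x -> f_ m x @[m --> \oo] --> f x) ->
  \int[mu]_(x in D) f_ m x @[m --> \oo] --> \int[mu]_(x in D) f x.
Proof.
move=> mf fC cf.
have mlim : measurable_fun D f by exact: (measurable_realfun.measurable_fun_cvg mf).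
have fC' x : D x -> `|f x| <= C.
  move=> Dx; have : `|f_ m x| @[m --> \oo] --> `|f x|.
    by apply: cvg_norm; exact: cf.
  by move=> /cvgr_to_le; apply; apply: nearW => m; exact: fC.
have h : (\int[mu]_(x in D) (f_ m x)%:E @[m --> \oo] --> \int[mu]_(x in D) (f x)%:E)%E.
  apply: (@dominated_cvg _ _ _ _ _ mD (fun m x => (f_ m x)%:E) _ (fun=> C%:E)) => //.
  - by move=> m; exact/measurable_EFinP.
  - by move=> x Dx; apply: cvg_EFin; [exact: nearW|exact: cf].
  - by apply/(@bounded_fun_integrable (fun=> C) `|C|).
rewrite -(fineK (integrable_fin_num mD (bounded_fun_integrable mlim fC'))) in h.
exact: ((fine_cvgP _ _).1 h).2.
Qed.

End real_integrals.

(** * Square-integrable functions *)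

Section square_integrable.
Context d (T : measurableType d) (R : realType).
Variables (mu : {measure set T -> \bar R}) (D : set T).

Definition sqint (u : T -> R) : Prop :=
  measurable_fun D u /\ mu.-integrable D (EFin \o (fun x => u x ^+ 2)).

Definition ip (u v : T -> R) : R := \int[mu]_(x in D) (u x * v x).

Hypothesis mD : measurable D.

Lemma sqint_mul u v : sqint u -> sqint v ->
  mu.-integrable D (EFin \o (fun x => u x * v x)).
Proof.
move=> [mu_ iu] [mv iv].
apply: (le_integrable mD _ _ (integrableDR mD iu iv)).
  by apply/measurable_EFinP; exact: measurable_funM.
move=> x Dx; rewrite /= lee_fin (ger0_norm (addr_ge0 (sqr_ge0 _) (sqr_ge0 _))).
rewrite ler_norml; apply/andP; split.
  by have := sqr_ge0 (u x + v x); nra.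
by have := sqr_ge0 (u x - v x); nra.
Qed.

Lemma sqintD u v : sqint u -> sqint v -> sqint (fun x => u x + v x).
Proof.
move=> su sv; have iuv := sqint_mul su sv; case: su sv => mu_ iu [mv iv]; split.
  exact: measurable_funD.
rewrite (_ : EFin \o _ =
  EFin \o (fun x => (u x ^+ 2 + v x ^+ 2) + 2 * (u x * v x))); last first.
  by apply/funext => x /=; congr EFin; ring.
exact: (integrableDR mD (integrableDR mD iu iv) (integrableZR mD 2 iuv)).
Qed.

Lemma sqintZ c u : sqint u -> sqint (fun x => c * u x).
Proof.
move=> [mu_ iu]; split; first exact: measurable_funM.
rewrite (_ : EFin \o _ = EFin \o (fun x => c ^+ 2 * (u x ^+ 2))); last first.
  by apply/funext => x /=; congr EFin; ring.
exact: (integrableZR mD (c ^+ 2) iu).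
Qed.

Lemma sqintB u v : sqint u -> sqint v -> sqint (fun x => u x - v x).
Proof.
move=> su sv; rewrite (_ : (fun x => _) = (fun x => u x + (-1) * v x)).
  by apply: sqintD => //; exact: sqintZ.
by apply/funext => x; rewrite mulN1r.
Qed.

Lemma sqint0 : sqint (fun=> 0).
Proof.
split; first exact: measurable_cst.
rewrite (_ : EFin \o _ = cst 0%E); first exact: integrable0.
by apply/funext => x /=; rewrite expr0n.
Qed.

Lemma sqint_sum (I : Type) (s : seq I) (f : I -> T -> R) :
  (forall i, sqint (f i)) -> sqint (fun x => \sum_(i <- s) f i x).
Proof.
move=> sf; elim: s => [|i s IH].
  rewrite (_ : (fun x => _) = (fun=> 0)); first exact: sqint0.
  by apply/funext => x; rewrite big_nil.
rewrite (_ : (fun x => _) = (fun x => f i x + \sum_(j <- s) f j x)).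
  exact: sqintD.
by apply/funext => x; rewrite big_cons.
Qed.

Lemma bounded_sqint (u : T -> R) (C : R) : (mu D < +oo)%E -> measurable_fun D u ->
  (forall x, D x -> `|u x| <= C) -> sqint u.
Proof.
move=> Doo mu_ uC; split => //.
apply: (bounded_fun_integrable mD Doo (C := C ^+ 2)).
  exact: measurable_funX.
by move=> x Dx; rewrite normrX lerXn2r ?nnegrE// ?uC// (le_trans _ (uC x Dx)).
Qed.

Lemma ipC u v : ip u v = ip v u.
Proof. by apply: eq_Rintegral => x _; rewrite mulrC. Qed.

Lemma ip_ge0 u : 0 <= ip u u.
Proof. by apply: Rintegral_ge0 => x _; rewrite -expr2 sqr_ge0. Qed.

Lemma ipDl u v w : sqint u -> sqint v -> sqint w ->
  ip (fun x => u x + v x) w = ip u w + ip v w.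
Proof.
move=> su sv sw; rewrite /ip -RintegralD//; [|exact: sqint_mul..].
by apply: eq_Rintegral => x _; rewrite mulrDl.
Qed.

Lemma ipZl c u v : sqint u -> sqint v -> ip (fun x => c * u x) v = c * ip u v.
Proof.
move=> su sv; rewrite /ip -RintegralZl//; last exact: sqint_mul.
by apply: eq_Rintegral => x _; rewrite mulrA.
Qed.

Lemma ipBl u v w : sqint u -> sqint v -> sqint w ->
  ip (fun x => u x - v x) w = ip u w - ip v w.
Proof.
move=> su sv sw; rewrite /ip -RintegralB//; [|exact: sqint_mul..].
by apply: eq_Rintegral => x _; rewrite mulrBl.
Qed.

Lemma ip_suml (I : Type) (s : seq I) (f : I -> T -> R) v :
  (forall i, sqint (f i)) -> sqint v ->
  ip (fun x => \sum_(i <- s) f i x) v = \sum_(i <- s) ip (f i) v.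
Proof.
move=> sf sv; rewrite /ip -Rintegral_sum//; last by move=> i; exact: sqint_mul.
by apply: eq_Rintegral => x _; rewrite mulr_suml.
Qed.

(** The discriminant of the nonnegative quadratic polynomial
    [t |-> ip (u + t v) (u + t v)] is nonpositive. *)
Lemma ip_cauchy_schwarz u v : sqint u -> sqint v ->
  ip u v ^+ 2 <= ip u u * ip v v.
Proof.
move=> su sv.
have key a b : 0 <= a ^+ 2 * ip u u + 2 * a * b * ip u v + b ^+ 2 * ip v v.
  have sau := sqintZ a su; have sbv := sqintZ b sv.
  have := ip_ge0 (fun x => a * u x + b * v x).
  rewrite ipDl//; last exact: sqintD.
  rewrite 2!(ipC _ (fun x => _ + _)) !ipDl// !ipZl// !(ipC _ (fun x => _ * _)) !ipZl//.
  move=> h0; apply: (le_trans h0); rewrite (ipC v u) le_eqVlt; apply/orP; left; apply/eqP; ring.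
have [v0|v0] := eqVneq (ip v v) 0.
  rewrite v0 mulr0; have [->|q0] := eqVneq (ip u v) 0; first by rewrite expr0n.
  have := key 1 (- ((ip u u + 1) / (2 * ip u v))).
  have -> : 2 * 1 * - ((ip u u + 1) / (2 * ip u v)) * ip u v = - (ip u u + 1) by field.
  by rewrite v0 => h; exfalso; lra.
have v0' : 0 < ip v v by rewrite lt_neqAle eq_sym v0 ip_ge0.
have := key (ip v v) (- ip u v).
set p := ip u u; set q := ip u v; set r := ip v v in v0' *.
by move=> h; have : 0 <= r * (r * p - q ^+ 2); [nra|rewrite pmulr_rge0// subr_ge0 mulrC].
Qed.

Lemma ipBB u v : sqint u -> sqint v ->
  ip (fun x => u x - v x) (fun x => u x - v x) = ip u u - 2 * ip u v + ip v v.
Proof.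
move=> su sv; have sb := sqintB su sv.
rewrite ipBl// 2!(ipC _ (fun x => _ - _)) !ipBl// (ipC v u).
ring.
Qed.

(** Bessel: the squared norm of [c] minus its projection is nonnegative. *)
Lemma ip_bessel k (u : 'I_k -> T -> R) c : (forall j, sqint (u j)) -> sqint c ->
  (forall i j, ip (u i) (u j) = (i == j)%:R) ->
  \sum_j ip (u j) c ^+ 2 <= ip c c.
Proof.
move=> su sc ou; pose w x := \sum_j ip (u j) c * u j x.
have sw : sqint w by apply: sqint_sum => j; exact: sqintZ.
have cw : ip c w = \sum_j ip (u j) c ^+ 2.
  rewrite ipC ip_suml//; last by move=> j; exact: sqintZ.
  by apply: eq_bigr => j _; rewrite ipZl// expr2.
have ww : ip w w = \sum_j ip (u j) c ^+ 2.
  rewrite {1}/w ip_suml//; last by move=> j; exact: sqintZ.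
  apply: eq_bigr => j _; rewrite ipZl// (ipC _ w) /w ip_suml//; last by move=> i; exact: sqintZ.
  rewrite (bigD1 j)//= big1 ?addr0 ?ipZl// ?ou ?eqxx ?mulr1//.
  by move=> i ij; rewrite ipZl// ou (negPf ij) mulr0.
have := ip_ge0 (fun x => c x - w x); rewrite ipBB// cw ww.
by set S := \sum_j _; lra.
Qed.

Lemma ip_cvg (u_ v_ : nat -> T -> R) u v :
  (forall m, sqint (u_ m)) -> (forall m, sqint (v_ m)) -> sqint u -> sqint v ->
  ip (fun x => u_ m x - u x) (fun x => u_ m x - u x) @[m --> \oo] --> 0 ->
  ip (fun x => v_ m x - v x) (fun x => v_ m x - v x) @[m --> \oo] --> 0 ->
  ip (u_ m) (v_ m) @[m --> \oo] --> ip u v.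
Proof.
move=> su_ sv_ su sv cu cv.
have small (a_ : nat -> T -> R) (w : T -> R) : (forall m, sqint (a_ m)) -> sqint w ->
    ip (a_ m) (a_ m) @[m --> \oo] --> 0 -> ip (a_ m) w @[m --> \oo] --> 0.
  move=> sa sw ca; apply/norm_cvg0P.
  have : Num.sqrt (ip (a_ m) (a_ m) * ip w w) @[m --> \oo] --> (0 : R).
    have -> : (0 : R) = Num.sqrt (0 * ip w w) by rewrite mul0r sqrtr0.
    apply: continuous_cvg; first exact: sqrt_continuous.
    by apply: cvgM => //; exact: cvg_cst.
  apply: squeeze_cvgr; last exact: cvg_cst.
  apply: nearW => m; rewrite normr_ge0/= -sqrtr_sqr ler_sqrt ?ip_cauchy_schwarz//.
  by rewrite mulr_ge0 ?ip_ge0.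
pose a_ m x := u_ m x - u x; pose b_ m x := v_ m x - v x.
have sa m : sqint (a_ m) by exact: sqintB.
have sb m : sqint (b_ m) by exact: sqintB.
have cab : ip (a_ m) (b_ m) @[m --> \oo] --> 0.
  apply/norm_cvg0P.
  have : (ip (a_ m) (a_ m) + ip (b_ m) (b_ m)) @[m --> \oo] --> (0 : R).
    by rewrite -[X in _ --> X]addr0; exact: cvgD.
  apply: squeeze_cvgr; last exact: cvg_cst.
  apply: nearW => m; rewrite normr_ge0/=.
  have := ip_cauchy_schwarz (sa m) (sb m).
  have := ip_ge0 (a_ m); have := ip_ge0 (b_ m).
  set p := ip (a_ m) (a_ m); set q := ip (b_ m) (b_ m); set r := ip (a_ m) (b_ m).
  move=> q0 p0 h; rewrite ler_norml; apply/andP; split; nra.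
have E m : ip (u_ m) (v_ m) = ip (a_ m) (b_ m) + ip (a_ m) v + ip (b_ m) u + ip u v.
  have -> : ip (a_ m) (b_ m) = ip (u_ m) (b_ m) - ip u (b_ m) by exact: ipBl.
  have -> : ip (a_ m) v = ip (u_ m) v - ip u v by exact: ipBl.
  have -> : ip (b_ m) u = ip (v_ m) u - ip v u by exact: ipBl.
  rewrite 2!(ipC _ (b_ m)).
  have -> : ip (b_ m) (u_ m) = ip (v_ m) (u_ m) - ip v (u_ m) by exact: ipBl.
  have -> : ip (b_ m) u = ip (v_ m) u - ip v u by exact: ipBl.
  rewrite (ipC (v_ m) (u_ m)) (ipC v (u_ m)); ring.
rewrite (_ : (fun m => _) = (fun m => ip (a_ m) (b_ m) + ip (a_ m) v + ip (b_ m) u + ip u v)).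
  rewrite -[X in _ --> X]add0r; apply: cvgD; last exact: cvg_cst.
  rewrite -[X in _ --> X]addr0; apply: cvgD; last exact: small.
  rewrite -[X in _ --> X]addr0; apply: cvgD; first exact: cab.
  exact: small.
by apply/funext => m; exact: E.
Qed.

End square_integrable.

(** * Borel sets of row vectors and iterated integrals *)

Section row_vectors.
Context (R : realType) (n : nat).
Local Notation E := 'rV[R]_n.

Lemma ler_coord_norm (x : E) i : `|x ord0 i| <= `|x|.
Proof.
rewrite [leRHS]/Num.norm/= mx_normrE.
exact: (le_bigmax _ (fun ij : 'I_1 * 'I_n => `|x ij.1 ij.2|) (ord0, i)).
Qed.

Lemma rV_norm_lt (x : E) (e : R) : 0 < e -> (forall i, `|x ord0 i| < e) -> `|x| < e.
Proof.
move=> e0 xe; rewrite [ltLHS]/Num.norm/= mx_normrE.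
by apply/bigmax_ltP; split => // -[i j] _ /=; rewrite (ord1 i).
Qed.

Lemma measurable_rV_cylinder (J : 'I_n -> set R) : (forall i, measurable (J i)) ->
  measurable [set x : E | forall i, J i (x ord0 i)].
Proof.
move=> mJ; rewrite (_ : [set x | _] =
    \big[setI/setT]_(i < n) ((fun x : E => x ord0 i) @^-1` J i)).
  apply: bigsetI_measurable => i _.
  by rewrite -[X in measurable X]setTI; exact: measurable_coord.
rewrite -bigcap_seq; apply/seteqP; split => [x Jx i _|x Jx i]; first exact: Jx.
by apply: Jx => /=; rewrite mem_index_enum.
Qed.

(** The open boxes with rational centres and radii form a countable base. *)
Lemma rV_open_measurable (U : set E) : open U -> measurable U.
Proof.
move=> oU.
pose B (qk : 'rV[rat]_n * nat) : set E :=
  [set x | forall i, ball (ratr (qk.1 ord0 i) : R) (qk.2.+1%:R^-1) (x ord0 i)].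
pose F qk := if pselect (B qk `<=` U) then B qk else set0.
have -> : U = \bigcup_qk F qk.
  apply/seteqP; split => [x Ux|x [qk _]]; last first.
    by rewrite /F; case: pselect => // BU /BU.
  have /nbhs_ballP [e /= e0 eU] : nbhs x U by apply: open_nbhs_nbhs.
  pose k := Num.truncn (2 / e).
  have ke : 2 * k.+1%:R^-1 < e.
    rewrite ltr_pdivrMr// mulrC -ltr_pdivrMr//.
    exact: truncnS_gt.
  have k0 : 0 < k.+1%:R^-1 :> R by rewrite invr_gt0.
  have qP i : exists q : rat, ratr q \in `]x ord0 i - k.+1%:R^-1, x ord0 i + k.+1%:R^-1[.
    by apply: rat_in_itvoo; rewrite ltrD2l -subr_gt0 opprK addr_gt0.
  pose q := \row_i projT1 (cid (qP i)).
  have qx i : `|ratr (q ord0 i) - x ord0 i| < k.+1%:R^-1.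
    rewrite /q mxE; case: cid => /= r; rewrite in_itv/= => /andP[h1 h2].
      by rewrite ltr_distl; move: h1 h2; set kk := _^-1; lra.
  exists (q, k) => //; rewrite /F; case: pselect => [_ i|[]] /=.
    by rewrite -ball_normE/=.
  move=> y By; apply: eU; split => // i j; rewrite (ord1 i) -ball_normE /=.
  have := By j; rewrite -ball_normE/= => yj.
  rewrite (le_lt_trans (ler_distD (ratr (q ord0 j) : R) _ _))//.
  by rewrite (lt_trans _ ke)// mulr_natl mulr2n ltrD// distrC.
apply: countable_bigcupT_measurable; first exact: countableP.
move=> qk; rewrite /F; case: pselect => [h|h]; last exact: measurable0.
apply: (@measurable_rV_cylinder (fun i => ball (ratr (qk.1 ord0 i) : R) qk.2.+1%:R^-1)).
by move=> i; exact: measurable_ball.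
Qed.

Lemma continuous_rV_measurable (f : E -> R) : continuous f -> measurable_fun setT f.
Proof.
move=> cf; apply: (measurability _ (RGenOpens.measurableE R)).
move=> _ [_ [a [b ->] <-]]; rewrite setTI; apply: rV_open_measurable.
by move/continuousP : cf; apply; exact: interval_open.
Qed.

End row_vectors.

Section lebesgue_rV_theory.
Context (R : realType).
Local Notation mu := (@lebesgue_rV R).

Lemma lebesgue_rVS_xsection n (A : set 'rV[R]_n.+1) :
  mu n.+1 A = (\int[lebesgue_measure]_x mu n [set v | A (rV_cons (x, v))])%E.
Proof.
rewrite /= /lebesgue_step /pushforward /= /product_measure1.
by apply: eq_integral => x _ /=; congr (mu n _); apply/seteqP; split => v /=; rewrite /xsection /= inE.
Qed.

(** Tonelli's theorem, peeling off the first coordinate. *)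
Lemma lebesgue_rVS_integral n (A : set R) (B : set 'rV[R]_n) (f : 'rV[R]_n.+1 -> \bar R) :
  measurable A -> measurable B -> measurable_fun setT f -> (forall x, 0 <= f x)%E ->
  (\int[mu n.+1]_(v in [set v | A (rV_uncons v).1 /\ B (rV_uncons v).2]) f v =
   \int[lebesgue_measure]_(x in A) \int[mu n]_(w in B) f (rV_cons (x, w)))%E.
Proof.
move=> mA mB mf f0.
have mAB : measurable [set v : 'rV[R]_n.+1 | A (rV_uncons v).1 /\ B (rV_uncons v).2].
  rewrite (_ : [set v | _] = @rV_uncons R n @^-1` (A `*` B))//.
  by rewrite -[X in measurable X]setTI; apply: measurable_rV_uncons => //; exact: measurableX.
transitivity (\int[(lebesgue_measure \x mu n)%E]_(p in A `*` B) (f \o @rV_cons R n) p)%E.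
  have -> : A `*` B = @rV_cons R n @^-1` [set v | A (rV_uncons v).1 /\ B (rV_uncons v).2].
    by apply/seteqP; split => p; rewrite /preimage /mkset rV_consK.
  apply: (@ge0_integral_pushforward _ _ _ _ _ _ (@measurable_rV_cons R n)
    (lebesgue_measure \x mu n)%E) => //.
  exact: measurable_funTS.
rewrite integral_mkcond fubini_tonelli1//; last 2 first.
- apply/(measurable_restrictT _ (measurableX mA mB)).
  apply: measurable_funTS; apply: measurableT_comp => //; exact: measurable_rV_cons.
- by move=> x; rewrite patchE; case: ifPn => //= _; exact: f0.
rewrite [RHS]integral_mkcond; apply: eq_integral => x _; rewrite /fubini_F /= [RHS]patchE.
case: ifPn => xA.
  rewrite [RHS]integral_mkcond; apply: eq_integral => v _; rewrite !patchE/= in_setX/=.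
  by rewrite xA.
apply: integral0_eq => v _; rewrite patchE in_setX/=.
by rewrite (negPf xA).
Qed.

Lemma lebesgue_rV_cylinder n (J : 'I_n -> set R) : (forall i, measurable (J i)) ->
  (mu n [set x : 'rV[R]_n | forall i, J i (x ord0 i)] = \prod_(i < n) lebesgue_measure (J i))%E.
Proof.
elim: n J => [J _|n IH J mJ].
  rewrite big_ord0 /= diracE mem_set// => -[]//.
rewrite big_ord_recl -IH; last by move=> i; exact: mJ.
rewrite /= /lebesgue_step /pushforward.
rewrite (_ : _ @^-1` _ = J ord0 `*` [set v : 'rV[R]_n | forall i, J (lift ord0 i) (v ord0 i)]).
  have mC : measurable [set v : 'rV[R]_n | forall i, J (lift ord0 i) (v ord0 i)].
    by apply: (@measurable_rV_cylinder R n (fun i => J (lift ord0 i))) => i; exact: mJ.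
  by rewrite product_measure1E//; do ?[exact: mC|exact: mJ].
apply/seteqP; split => -[x v] /=.
  move=> h; split; first by have := h ord0; rewrite mxE unlift_none.
  by move=> i; have := h (lift ord0 i); rewrite mxE liftK.
move=> [h0 h] i; rewrite mxE; case: unliftP => [j ->|->] //=; exact: h.
Qed.

End lebesgue_rV_theory.

(** * Dilations, boxes and balls *)

Section dilations.
Context (R : realType).
Local Notation mu := (@lebesgue_rV R).
Local Notation leb := (@lebesgue_measure R).
Variable s : R.
Hypothesis s0 : 0 < s.

Let dil (x : measurableTypeR R) : measurableTypeR R := s * x.

Let measurable_dil : measurable_fun setT dil.
Proof. exact: measurable_funM. Qed.

Let push : {measure set (measurableTypeR R) -> \bar R} :=
  measure_function_pushforward__canonical__measure_function_Measure
    (leb : {measure set _ -> \bar R}) measurable_dil.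

Let lebesgue_push (A : set (measurableTypeR R)) : measurable A ->
  (leb A = mscale (NngNum (ltW s0)) push A)%E.
Proof.
apply: lebesgue_measure_unique => _ [[a b] _ <-].
change (leb `]a, b]%classic = s%:E * leb (dil @^-1` `]a, b]%classic))%E.
rewrite (_ : dil @^-1` _ = `](a / s), (b / s)]%classic); last first.
  apply/seteqP; split => x /=; rewrite !in_itv/= /dil ltr_pdivrMr// ler_pdivlMr//;
  by rewrite ![x * s]mulrC.
rewrite !lebesgue_measure_itv/= !lte_fin ltr_pM2r ?invr_gt0//.
case: ifPn => _; last by rewrite mule0.
by rewrite -!EFinB -EFinM; congr EFin; field; rewrite gt_eqF.
Qed.

(** [A |-> s * leb (s^-1 A)] agrees with the Lebesgue measure on intervals. *)
Lemma integral_dil (f : R -> \bar R) : measurable_fun setT f -> (forall x, 0 <= f x)%E ->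
  (\int[leb]_x f (s * x)%R = (s^-1)%:E * \int[leb]_x f x)%E.
Proof.
move=> mf f0.
rewrite [in RHS](@eq_measure_integral _ _ _ setT (mscale (NngNum (ltW s0)) push)); last first.
  by move=> A mA _; exact: lebesgue_push.
rewrite ge0_integral_mscale// muleA -EFinM mulVf ?gt_eqF// mul1e.
by rewrite (@ge0_integral_pushforward _ _ _ _ _ _ measurable_dil).
Qed.

(** Dilation of one coordinate at a time, by slicing along the first one. *)
Lemma lebesgue_rV_dil n (A : set 'rV[R]_n) : measurable A ->
  (mu n [set x | A (s *: x)] = (s ^- n)%:E * mu n A)%E.
Proof.
elim: n A => [A _|n IH A mA].
  rewrite expr0 invr1 mul1e; congr (mu 0 _); apply/funext => x.
  by rewrite /mkset; congr A; rewrite [LHS]thinmx0 [RHS]thinmx0.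
have mAc : measurable (@rV_cons R n @^-1` A).
  by rewrite -[X in measurable X]setTI; exact: measurable_rV_cons.
rewrite !lebesgue_rVS_xsection.
pose g (x : R) := mu n [set v | A (rV_cons (x, v))].
have gE : g = mu n \o xsection (@rV_cons R n @^-1` A).
  apply/funext => x /=; congr (mu n _); apply/seteqP.
  by split => v; rewrite /xsection /= inE.
have mg : measurable_fun setT g by rewrite gE; exact: measurable_fun_xsection.
rewrite (_ : \int[leb]_x _ = \int[leb]_x ((s ^- n)%:E * g (s * x)%R))%E; last first.
  apply: eq_integral => x _ /=; rewrite /g -IH; last first.
    rewrite (_ : [set v | _] = xsection (@rV_cons R n @^-1` A) (s * x)).
      exact: measurable_xsection.
    by apply/seteqP; split => v; rewrite /xsection /= inE.
  congr (mu n _); apply/seteqP; split => v /=.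
    rewrite (_ : s *: rV_cons (x, v) = rV_cons (s * x, s *: v))//.
    by apply/rowP => i; rewrite !mxE; case: unliftP => //= j _; rewrite mxE.
  rewrite (_ : s *: rV_cons (x, v) = rV_cons (s * x, s *: v))//.
  by apply/rowP => i; rewrite !mxE; case: unliftP => //= j _; rewrite mxE.
rewrite ge0_integralZl//; last 2 first.
- apply: (measurableT_comp mg); exact: measurable_dil.
- by rewrite lee_fin invr_ge0 exprn_ge0// ltW.
rewrite (integral_dil mg)// muleA -EFinM; congr (_%:E * _)%E.
by rewrite -invfM -exprSr.
Qed.

End dilations.

Section balls.
Context (R : realType) (n : nat).
Local Notation E := 'rV[R]_n.
Local Notation mu := (@lebesgue_rV R n).
Implicit Types (x y : E) (L c r : R).

Definition sqnorm (x : E) : R := \sum_i x ord0 i ^+ 2.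

Lemma sqnorm_ge0 x : 0 <= sqnorm x.
Proof. by apply: sumr_ge0 => i _; exact: sqr_ge0. Qed.

Lemma sqnormZ c x : sqnorm (c *: x) = c ^+ 2 * sqnorm x.
Proof. by rewrite mulr_sumr; apply: eq_bigr => i _; rewrite mxE exprMn. Qed.

Lemma coord_sqnorm x i : x ord0 i ^+ 2 <= sqnorm x.
Proof. by rewrite /sqnorm (bigD1 i)//= lerDl sumr_ge0// => j _; exact: sqr_ge0. Qed.

Lemma measurable_sqnorm : measurable_fun setT sqnorm.
Proof. by apply: measurable_sum => i; apply: measurable_funX; exact: measurable_coord. Qed.

Definition cube (L : R) : set E := [set x | forall i, `[- L, L]%classic (x ord0 i)].

Lemma measurable_cube L : measurable (cube L).
Proof. by apply: (@measurable_rV_cylinder R n (fun=> `[- L, L]%classic)) => i; exact: measurable_itv. Qed.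

Lemma cubeP L x : cube L x <-> forall i, `|x ord0 i| <= L.
Proof. by split => h i; have := h i; rewrite /= in_itv /= ler_norml. Qed.

Lemma lebesgue_rV_cube L : 0 <= L -> mu (cube L) = ((2 * L) ^+ n)%:E.
Proof.
move=> L0; rewrite (@lebesgue_rV_cylinder R n (fun=> `[- L, L]%classic))//.
rewrite (_ : lebesgue_measure `[- L, L]%classic = (2 * L)%:E).
  by rewrite prodEFin prodr_const card_ord.
rewrite lebesgue_measure_itv/= lte_fin.
case: ltP => [_|h]; first by rewrite -EFinB; congr EFin; ring.
by congr EFin; lra.
Qed.

Lemma bounded_sub_cube (A : set E) : bounded_set A -> exists2 L, 0 < L & A `<=` cube L.
Proof.
move=> [M [_ hM]]; exists (`|M| + 1); first by rewrite ltr_pwDr.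
move=> x Ax; apply/cubeP => i.
have := hM (`|M| + 1) (le_lt_trans (ler_norm _) (ltr_pwDr ltr01 (lexx _))) x Ax.
exact: le_trans (ler_coord_norm _ _).
Qed.

Lemma sub_cube_finite (A : set E) L : measurable A -> 0 <= L -> A `<=` cube L -> (mu A < +oo)%E.
Proof.
move=> mA L0 AL; apply: (@le_lt_trans _ _ (mu (cube L))).
  by apply: le_measure; rewrite ?inE//; exact: measurable_cube.
by rewrite lebesgue_rV_cube// ltry.
Qed.

Lemma bounded_finite (A : set E) : measurable A -> bounded_set A -> (mu A < +oo)%E.
Proof.
move=> mA /bounded_sub_cube[L L0]; exact: sub_cube_finite mA (ltW L0).
Qed.

Lemma open_lebesgue_rV_gt0 (A : set E) : open A -> A !=set0 -> (0 < mu A)%E.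
Proof.
move=> oA [x Ax]; have /nbhs_ballP[e /= e0 eA] : nbhs x A by apply: open_nbhs_nbhs.
pose J i := `]x ord0 i - e, x ord0 i + e[%classic.
have mJ i : measurable (J i) by exact: measurable_itv.
have mB := measurable_rV_cylinder mJ.
apply: (@lt_le_trans _ _ (mu [set y | forall i, J i (y ord0 i)])); last first.
  apply: le_measure; rewrite ?inE//; first exact: rV_open_measurable.
  move=> y Jy; apply: eA; split => // i j; rewrite (ord1 i) -ball_normE /=.
  by have := Jy j; rewrite /J/= in_itv/= ltr_distlC.
rewrite lebesgue_rV_cylinder//.
under eq_bigr => i _ do rewrite /J lebesgue_measure_itv/= lte_fin ltrD2l gtrN// -EFinB.
rewrite prodEFin lte_fin; apply: prodr_gt0 => i _; lra.
Qed.

Lemma measurable_sqnorm_lt c : measurable [set x : E | sqnorm x < c].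
Proof.
rewrite (_ : [set x | _] = sqnorm @^-1` `]-oo, c[%classic).
  by rewrite -[X in measurable X]setTI; apply: measurable_sqnorm => //; exact: measurable_itv.
by apply/seteqP; split => x /=; rewrite in_itv.
Qed.

Lemma sqnorm_lt_cube c : [set x : E | sqnorm x < c ^+ 2] `<=` cube `|c|.
Proof.
move=> x /= xc; apply/cubeP => i.
rewrite -ler_sqr ?nnegrE// !real_normK ?num_real//.
exact: le_trans (coord_sqnorm _ _) (ltW xc).
Qed.

Lemma unit_ballE : @unit_ball R n = [set x | sqnorm x < 1 ^+ 2].
Proof. by rewrite expr1n. Qed.

Definition omega : R := fine (mu (@unit_ball R n)).

Lemma omegaE : mu (@unit_ball R n) = omega%:E.
Proof.
rewrite fineK// ge0_fin_numE// unit_ballE.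
by apply: (sub_cube_finite _ _ (@sqnorm_lt_cube 1)) => //; exact: measurable_sqnorm_lt.
Qed.

Lemma omega_gt0 : 0 < omega.
Proof.
have : (0 < mu (@unit_ball R n))%E; last by rewrite omegaE lte_fin.
apply: (@lt_le_trans _ _ (mu (ball (0 : E) (n.+1%:R^-1)))).
  apply: open_lebesgue_rV_gt0; first exact: ball_open.
  by exists 0; apply: ballxx; rewrite invr_gt0.
apply: le_measure; rewrite ?inE.
- by apply: rV_open_measurable; exact: ball_open.
- by rewrite unit_ballE; exact: measurable_sqnorm_lt.
move=> x [_ xb]; rewrite unit_ballE /= /sqnorm.
have xi i : x ord0 i ^+ 2 <= n.+1%:R^-1.
  have := xb ord0 i; rewrite -ball_normE/= mxE sub0r normrN => h.
  have : n.+1%:R^-1 <= 1 :> R by rewrite invf_le1// ler1n.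
  have e0 : 0 < n.+1%:R^-1 :> R by rewrite invr_gt0.
  move: h e0; rewrite -normr_id -[x ord0 i ^+ 2]real_normK ?num_real//.
  by set e := _^-1; rewrite normr_id; have := normr_ge0 (x ord0 i); nra.
apply: (@le_lt_trans _ _ (\sum_(i < n) n.+1%:R^-1)); first exact: ler_sum.
rewrite sumr_const card_ord expr1n -[ltLHS]mulr_natl ltr_pdivrMr// mul1r.
by rewrite ltr_nat.
Qed.

Lemma lebesgue_rV_ball r : 0 < r -> mu [set x | sqnorm x < r ^+ 2] = (r ^+ n * omega)%:E.
Proof.
move=> r0.
have r'0 : 0 < r^-1 by rewrite invr_gt0.
have := lebesgue_rV_dil r'0 (@measurable_sqnorm_lt (1 ^+ 2)).
rewrite -unit_ballE omegaE => h.
rewrite (_ : [set x | _] = [set x : E | @unit_ball R n (r^-1 *: x)]).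
  by rewrite h exprVn invrK -EFinM.
have E0 a : (r^-1 ^+ 2 * a < 1 ^+ 2) = (a < r ^+ 2).
  by rewrite expr1n exprVn mulrC ltr_pdivrMr ?exprn_gt0// mul1r.
by apply/seteqP; split => x; rewrite unit_ballE /mkset sqnormZ E0.
Qed.

End balls.

(** * Trigonometric polynomials on the dual cell of a lattice *)

Section trigonometric_integrals.
Context (R : realType).
Local Notation mu := (@lebesgue_rV R).

Lemma sin_int_pi (j : int) : sin (j%:~R * pi) = 0 :> R.
Proof.
have sin_nat k : sin (k%:R * pi) = 0 :> R.
  elim: k => [|k IH]; first by rewrite mul0r sin0.
  by rewrite -natr1 mulrDl mul1r sinD IH sinpi mul0r mulr0 addr0.
by case: j => k; rewrite ?NegzE ?mulrNz ?mulNr ?sinN ?[_%:~R]pmulrn sin_nat ?oppr0.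
Qed.

Lemma integral_affine_cos (K b a c L : R) (j : int) : 0 < L -> a * L = j%:~R * pi ->
  (\int[@lebesgue_measure R]_(x in `[(- L)%R, L%R]) (K * (1 + b * cos (a * x + c)))%R%:E =
   (K * (2 * L * (1 + b * (a == 0)%:R * cos c)))%R%:E)%E.
Proof.
move=> L0 aL.
pose F x := if a == 0 then K * (1 + b * cos c) * x else K * (x + b * (a^-1 * sin (a * x + c))).
have dF (x : R) : is_derive x (1 : R) F (K * (1 + b * cos (a * x + c))).
  have dmul (k : R) (f : R -> R) (df y : R) : is_derive y (1 : R) f df ->
    is_derive y (1 : R) (fun y => k * f y) (k * df) by move=> h; exact: is_deriveZ.
  have dadd (f g : R -> R) (df dg y : R) : is_derive y (1 : R) f df -> is_derive y (1 : R) g dg ->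
    is_derive y (1 : R) (fun y => f y + g y) (df + dg) by move=> h h'; exact: is_deriveD.
  rewrite /F; case: eqVneq => [->|a0].
    apply: (is_derive_eq (dmul _ _ _ _ (is_derive_id x 1))).
    by rewrite mul0r add0r mulr1.
  have dg := dadd _ _ _ _ _ (dmul a _ _ _ (is_derive_id x 1)) (is_derive_cst c x 1).
  have ds := @is_derive1_comp _ sin (fun y => a * y + c) _ _ _ (is_derive_sin (a * x + c)) dg.
  apply: (is_derive_eq (dmul K _ _ _ (dadd _ _ _ _ _ (is_derive_id x 1)
    (dmul b _ _ _ (dmul a^-1 _ _ _ ds))))).
  by rewrite /GRing.scale/=; field.
have cF (x : R) : {for x, continuous F}.
  by apply: differentiable_continuous; apply/derivable1_diffP; apply: ex_derive.
have LL : - L < L by move: L0; lra.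
have cf : {within `[- L, L], continuous (fun x : R => K * (1 + b * cos (a * x + c)) : R)}.
  apply: continuous_subspaceT => x; apply: cvgM; first exact: cvg_cst.
  apply: cvgD; first exact: cvg_cst.
  apply: cvgM; first exact: cvg_cst.
  apply: (@continuous_comp _ _ _ (fun x : R => a * x + c) cos); last exact: continuous_cos.
  apply: cvgD; last exact: cvg_cst.
  by apply: cvgM; [exact: cvg_cst|exact: cvg_id].
have dFo : derivable_oo_LRcontinuous F (- L) L.
  split => [x _||].
  + exact: ex_derive.
  + by apply: cvg_at_right_filter; exact: cF.
  + by apply: cvg_at_left_filter; exact: cF.
rewrite (continuous_FTC2 LL cf dFo); last by move=> x _; rewrite derive1E; exact: derive_val.
rewrite -EFinB; congr EFin; rewrite /F. case: (eqVneq a 0) => [_|a0].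
  rewrite /= mulr1; ring.
rewrite mulr0 mul0r addr0 mulrN !sinD !sinN cosN aL sin_int_pi; ring.
Qed.

Lemma measurable_dot n (a : 'I_n -> R) :
  measurable_fun [set: 'rV[R]_n] (fun x : 'rV[R]_n => \sum_i a i * x ord0 i).
Proof. by apply: measurable_sum => i; apply: measurable_funM => //; exact: measurable_coord. Qed.

Lemma measurable_cos_dot n (a : 'I_n -> R) c :
  measurable_fun [set: 'rV[R]_n] (fun x : 'rV[R]_n => cos (\sum_i a i * x ord0 i + c)).
Proof.
apply: measurableT_comp; first by apply: continuous_measurable_fun; exact: continuous_cos.
by apply: measurable_funD => //; exact: measurable_dot.
Qed.

(** The constant 1 makes the integrand nonnegative, so that Tonelli's theorem
    applies; the phase [c] absorbs the coordinates already integrated out. *)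
Lemma integral_cube_cos n (a : 'I_n -> R) (c L : R) : 0 < L ->
  (forall i, exists j : int, a i * L = j%:~R * pi) ->
  (\int[mu n]_(x in @cube R n L) (1 + cos (\sum_i a i * x ord0 i + c))%:E =
   ((2 * L) ^+ n * (1 + [forall i, a i == 0]%:R * cos c))%:E)%E.
Proof.
move=> L0; elim: n a c => [|n IH] a c aL.
  under eq_integral do rewrite big_ord0 add0r.
  rewrite integral_cst; last exact: measurable_cube.
  rewrite /= lebesgue_rV_cube ?ltW// -EFinM mulrC; congr (_ * _)%:E.
  by rewrite (_ : [forall i, _] = true) ?mul1r//; apply/forallP => -[].
have cubeS : @cube R n.+1 L =
    [set v : 'rV[R]_n.+1 | `[- L, L]%classic (rV_uncons v).1 /\ @cube R n L (rV_uncons v).2].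
  apply/seteqP; split => v /=; first by move=> h; split => [|i]; rewrite ?mxE; exact: h.
  move=> [h0 h] i; have [j ->|->] := unliftP ord0 i; last exact: h0.
  by have := h j; rewrite mxE.
have mf : measurable_fun setT (fun x : 'rV[R]_n.+1 => (1 + cos (\sum_i a i * x ord0 i + c))%:E).
  by apply/measurable_EFinP; apply: measurable_funD => //; exact: measurable_cos_dot.
have f0 (x : 'rV[R]_n.+1) : (0 <= (1 + cos (\sum_i a i * x ord0 i + c))%:E)%E.
  by rewrite lee_fin -lerBlDl sub0r cos_geN1.
rewrite cubeS (lebesgue_rVS_integral (measurable_itv `[- L, L]) (@measurable_cube R n L) mf f0).
pose z := [forall i, a (lift ord0 i) == 0].
transitivity (\int[lebesgue_measure]_(x in `[(- L)%R, L%R])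
    ((2 * L) ^+ n * (1 + z%:R * cos (a ord0 * x + c)))%:E)%E.
  apply: eq_integral => x _; rewrite -IH; last by move=> i; exact: aL.
  apply: eq_integral => v _; rewrite big_ord_recl mxE unlift_none /=.
  congr (1 + cos _)%:E; rewrite [RHS]addrCA addrA; congr (_ + _ + _).
  apply: eq_bigr => i _.
  by rewrite mxE liftK.
have [j aj] := aL ord0; rewrite (integral_affine_cos _ _ _ L0 aj) exprSr mulrA.
congr (_ * (1 + _ * _))%:E; rewrite -natrM mulnb; congr (_%:R); congr nat_of_bool.
apply/andP/forallP => [[/forallP az /eqP a0] i|az].
  by have [k ->|->] := unliftP ord0 i; [exact: az|rewrite a0].
by split; [apply/forallP => i; exact: az|exact: az].
Qed.

End trigonometric_integrals.

Section trigonometric_polynomials.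
Context (R : realType) (n : nat).
Local Notation E := 'rV[R]_n.
Local Notation mu := (@lebesgue_rV R n).

Definition dot (x y : E) : R := \sum_i x ord0 i * y ord0 i.

Lemma dotDl (x y z : E) : dot (x + y) z = dot x z + dot y z.
Proof. by rewrite -big_split; apply: eq_bigr => i _; rewrite mxE mulrDl. Qed.

Lemma dotBl (x y z : E) : dot (x - y) z = dot x z - dot y z.
Proof. by rewrite -sumrB; apply: eq_bigr => i _; rewrite !mxE mulrBl. Qed.

Lemma measurable_cos_dotl (a : E) : measurable_fun setT (fun x => cos (dot a x)).
Proof.
apply: measurableT_comp; last exact: measurable_dot.
by apply: continuous_measurable_fun; exact: continuous_cos.
Qed.

Lemma measurable_sin_dotl (a : E) : measurable_fun setT (fun x => sin (dot a x)).
Proof.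
apply: measurableT_comp; last exact: measurable_dot.
by apply: continuous_measurable_fun; exact: continuous_sin.
Qed.

Lemma cube_finite (L : R) : 0 <= L -> (mu (cube L) < +oo)%E.
Proof. by move=> L0; rewrite lebesgue_rV_cube// ltry. Qed.

Lemma integrable_cos_dot (D : set E) (a : E) : measurable D -> (mu D < +oo)%E ->
  mu.-integrable D (EFin \o (fun x => cos (dot a x))).
Proof.
move=> mD Doo; apply: (bounded_fun_integrable mD Doo (C := 1)) => [|x _]; last exact: cos_max.
by apply: measurable_funTS; exact: measurable_cos_dotl.
Qed.

Lemma Rintegral_cube_cos (a : E) (L : R) : 0 < L ->
  (forall i, exists j : int, a ord0 i * L = j%:~R * pi) ->
  \int[mu]_(x in cube L) cos (dot a x) = (2 * L) ^+ n * (a == 0)%:R.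
Proof.
move=> L0 aL; have L0' := ltW L0; have mL := @measurable_cube R n L.
have := integral_cube_cos 0 L0 aL; rewrite cos0 mulr1.
rewrite (_ : [forall i, a ord0 i == 0] = (a == 0)); last first.
  apply/forallP/eqP => [a0|-> i]; last by rewrite mxE.
  by apply/rowP => i; rewrite mxE; exact/eqP/a0.
move=> h; have {h} : \int[mu]_(x in cube L) (1 + cos (dot a x)) = (2 * L) ^+ n * (1 + (a == 0)%:R).
  by rewrite /Rintegral -[RHS]/(fine _%:E) -h; congr fine; apply: eq_integral => x _; rewrite addr0.
rewrite RintegralD//; last 2 first.
- by apply: (bounded_fun_integrable mL (cube_finite L0') (f := fun=> 1) (C := 1)) => [|x _]; rewrite ?normr1.
- exact: integrable_cos_dot (cube_finite L0').
rewrite Rintegral_cst//= lebesgue_rV_cube//= => /eqP.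
by rewrite mulrDr mulr1 mul1r => /eqP/addrI.
Qed.

Section trig_sum.
Variables (T : finType) (p : T -> E).
Implicit Types c : T -> R.

Definition cos_sum c (x : E) := \sum_k c k * cos (dot (p k) x).
Definition sin_sum c (x : E) := \sum_k c k * sin (dot (p k) x).
(** The squared modulus of [\sum_k c k * exp (i p k . x)], kept real. *)
Definition spectrum c (x : E) := cos_sum c x ^+ 2 + sin_sum c x ^+ 2.

Lemma measurable_cos_sum c : measurable_fun setT (cos_sum c).
Proof. by apply: measurable_sum => k; apply: measurable_funM => //; exact: measurable_cos_dotl. Qed.

Lemma measurable_sin_sum c : measurable_fun setT (sin_sum c).
Proof. by apply: measurable_sum => k; apply: measurable_funM => //; exact: measurable_sin_dotl. Qed.

Lemma measurable_spectrum c : measurable_fun setT (spectrum c).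
Proof.
by apply: measurable_funD; apply: measurable_funX; [exact: measurable_cos_sum|exact: measurable_sin_sum].
Qed.

Lemma spectrum_ge0 c x : 0 <= spectrum c x.
Proof. by rewrite addr_ge0 ?sqr_ge0. Qed.

Lemma cos_sum_le c x : `|cos_sum c x| <= \sum_k `|c k|.
Proof.
apply: (le_trans (ler_norm_sum _ _ _)); apply: ler_sum => k _.
by rewrite normrM ler_piMr// cos_max.
Qed.

Lemma sin_sum_le c x : `|sin_sum c x| <= \sum_k `|c k|.
Proof.
apply: (le_trans (ler_norm_sum _ _ _)); apply: ler_sum => k _.
by rewrite normrM ler_piMr// sin_max.
Qed.

Lemma spectrum_le c x : spectrum c x <= 2 * (\sum_k `|c k|) ^+ 2.
Proof.
rewrite mulr_natl mulr2n; apply: lerD; rewrite -real_normK ?num_real// lerXn2r ?nnegrE ?sumr_ge0//.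
  exact: cos_sum_le.
exact: sin_sum_le.
Qed.

Lemma spectrumE c x : spectrum c x = \sum_k \sum_l c k * c l * cos (dot (p k - p l) x).
Proof.
rewrite /spectrum !expr2 ![_ * _]big_distrlr /= -big_split; apply: eq_bigr => k _ /=.
rewrite -big_split; apply: eq_bigr => l _ /=.
by rewrite dotBl cosB; ring.
Qed.

(** Orthogonality of the exponentials on the dual cell of the lattice. *)
Lemma Rintegral_spectrum c L : 0 < L -> injective p ->
  (forall k l i, exists j : int, (p k - p l) ord0 i * L = j%:~R * pi) ->
  \int[mu]_(x in cube L) spectrum c x = (2 * L) ^+ n * \sum_k c k ^+ 2.
Proof.
move=> L0 injp pL; have mL := @measurable_cube R n L.
have Loo := cube_finite (ltW L0).
have icos k l : mu.-integrable (cube L) (EFin \o (fun x => c k * c l * cos (dot (p k - p l) x))).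
  by apply: (integrableZR mL); exact: integrable_cos_dot.
under eq_Rintegral do rewrite spectrumE.
rewrite Rintegral_sum//; last by move=> k; apply: integrable_sumR.
rewrite mulr_sumr; apply: eq_bigr => k _.
rewrite Rintegral_sum//.
transitivity (\sum_l c k * c l * ((2 * L) ^+ n * (k == l)%:R)).
  apply: eq_bigr => l _; rewrite RintegralZl//; last exact: integrable_cos_dot.
  by rewrite Rintegral_cube_cos// subr_eq0 (inj_eq injp).
rewrite (bigD1 k)//= big1 ?addr0 ?eqxx; last first.
  by move=> l lk; rewrite eq_sym (negPf lk) !mulr0.
by rewrite expr2 mulr1 mulrC.
Qed.

(** Differencing along the translation [v] multiplies the trigonometric
    polynomial by [exp (- i v . x) - 1]. *)
Lemma spectrum_diff c (tau : T -> T) (v x : E) : injective tau ->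
  (forall k, c (tau k) != 0 -> p (tau k) = p k + v) ->
  spectrum (fun k => c (tau k) - c k) x = (2 - 2 * cos (dot v x)) * spectrum c x.
Proof.
move=> tau_inj cv; set t := dot v x.
have shift (f g : R -> R) : (forall y, f (y - t) = f y * cos t + g y * sin t) ->
    \sum_k c (tau k) * f (dot (p k) x) =
    (\sum_k c k * f (dot (p k) x)) * cos t + (\sum_k c k * g (dot (p k) x)) * sin t.
  move=> fg; rewrite !mulr_suml -big_split /= [RHS](reindex_inj tau_inj) /=.
  apply: eq_bigr => k _; have [->|ck] := eqVneq (c (tau k)) 0; first by rewrite !mul0r addr0.
  have -> : dot (p k) x = dot (p (tau k)) x - t by rewrite cv// dotDl addrK.
  by rewrite fg; ring.
rewrite /spectrum /cos_sum /sin_sum.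
under eq_bigr do rewrite mulrBl.
under [X in _ + X ^+ 2]eq_bigr do rewrite mulrBl.
rewrite !sumrB (shift cos sin); last by move=> y; rewrite cosB.
rewrite (shift sin (fun y => - cos y)); last by move=> y /=; rewrite sinB; ring.
under [X in _ + (_ + X * _ - _) ^+ 2]eq_bigr do rewrite mulrN.
rewrite sumrN; have := cos2Dsin2 t.
set A := \sum_k _ * cos _; set B := \sum_k _ * sin _.
set C := cos t; set S := sin t => CS.
transitivity ((A ^+ 2 + B ^+ 2) * ((C ^+ 2 + S ^+ 2) + 1 - 2 * C)); first by ring.
by rewrite CS; ring.
Qed.

End trig_sum.
End trigonometric_polynomials.

(** * Riemann sums *)

Section riemann_sums.
Context (R : realType) (n : nat).
Local Notation E := 'rV[R]_n.
Local Notation mu := (@lebesgue_rV R n).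
Variable D : nat.

Definition mesh (m : nat) : R := m.+1%:R^-1.
Definition grid (m : nat) := {ffun 'I_n -> 'I_(2 * D * m.+1)}.
Definition node m (k : grid m) : E := \row_i (- D%:R + mesh m * (k i)%:R).
Definition box : set E := [set x | forall i, `[- D%:R, D%:R[%classic (x ord0 i)].
Definition cell m (k : grid m) : set E :=
  [set x | forall i, `[node k ord0 i, node k ord0 i + mesh m[%classic (x ord0 i)].
(** The function sampled at the lower corner of the cell that contains the
    point: its integral over the box is the Riemann sum. *)
Definition step m (g : E -> R) (x : E) : R := \sum_(k : grid m) g (node k) * \1_(cell k) x.
Definition riemann_sum m (g : E -> R) : R := mesh m ^+ n * \sum_(k : grid m) g (node k).

Lemma mesh_gt0 m : 0 < mesh m. Proof. by rewrite invr_gt0. Qed.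

Lemma measurable_box : measurable box.
Proof. by apply: (@measurable_rV_cylinder R n (fun=> `[- D%:R, D%:R[%classic)) => i; exact: measurable_itv. Qed.

Lemma measurable_cell m (k : grid m) : measurable (cell k).
Proof.
by apply: (@measurable_rV_cylinder R n
  (fun i => `[node k ord0 i, node k ord0 i + mesh m[%classic)) => i; exact: measurable_itv.
Qed.

Lemma lebesgue_rV_cell m (k : grid m) : mu (cell k) = (mesh m ^+ n)%:E.
Proof.
rewrite (@lebesgue_rV_cylinder R n (fun i => `[node k ord0 i, node k ord0 i + mesh m[%classic))//.
under eq_bigr => i _ do rewrite lebesgue_measure_itv/= lte_fin ltrDl mesh_gt0 -EFinB addrAC subrr add0r.
by rewrite prodEFin prodr_const card_ord.
Qed.

Lemma box_finite : (mu box < +oo)%E.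
Proof.
apply: (@le_lt_trans _ _ (mu (cube D%:R))); last by rewrite lebesgue_rV_cube// ltry.
apply: le_measure; rewrite ?inE; [exact: measurable_box|exact: measurable_cube|].
by move=> x xQ i; have := xQ i; rewrite /= !in_itv /= => /andP[-> /ltW ->].
Qed.

Lemma cell_sub_box m (k : grid m) : cell k `<=` box.
Proof.
move=> x xk i; have := xk i; rewrite /= !in_itv /= mxE => /andP[h1 h2].
have h0 := mesh_gt0 m; apply/andP; split.
  by apply: le_trans h1; rewrite lerDl mulr_ge0// ltW.
apply: (lt_le_trans h2); rewrite -addrA -lerBrDl opprK.
have -> : mesh m * (k i)%:R + mesh m = mesh m * (k i).+1%:R by rewrite -natr1 mulrDr mulr1.
rewrite /mesh ler_pdivrMl// -natrD -natrM ler_nat.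
by apply: leq_trans (ltn_ord (k i)) _; rewrite addnn -mul2n mulnC.
Qed.

Lemma cell_inj m (k l : grid m) x : cell k x -> cell l x -> k = l.
Proof.
move=> xk xl; apply/ffunP => i; apply/val_inj; apply/eqP.
have := xk i; have := xl i; rewrite /= !in_itv /= !mxE.
have h0 := mesh_gt0 m; move=> /andP[l1 l2] /andP[k1 k2].
have lt1 (a b : nat) : mesh m * a%:R < mesh m * b%:R + mesh m -> (a <= b)%N.
  rewrite -[X in _ + X]mulr1 -mulrDr ltr_pM2l// natr1 ltr_nat ltnS//.
by rewrite eqn_leq !lt1//; lra.
Qed.

Lemma boxP m x : box x -> exists k : grid m, cell k x.
Proof.
move=> xQ; have h0 := mesh_gt0 m.
pose a i := Num.truncn ((x ord0 i + D%:R) * m.+1%:R).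
have a0 i : 0 <= (x ord0 i + D%:R) * m.+1%:R.
  by have := xQ i; rewrite /= in_itv /= => /andP[h _]; rewrite mulr_ge0// -lerBlDr sub0r.
have aP i : (a i < 2 * D * m.+1)%N.
  rewrite truncn_lt_nat//; have := xQ i; rewrite /= in_itv /= => /andP[_ h].
  by rewrite natrM ltr_pM2r// natrM mulr_natl mulr2n ltrD2r.
exists [ffun i => Ordinal (aP i)] => i /=; rewrite in_itv /= mxE ffunE /= /mesh.
have /andP[] := truncn_itv (a0 i); rewrite -/(a i) => h1 h2.
have m0 : 0 < m.+1%:R :> R by [].
apply/andP; split.
  by rewrite -lerBrDl opprK ler_pdivrMl// mulrC.
rewrite -addrA -ltrBlDl opprK.
rewrite (_ : _ * _ + _ = (a i).+1%:R / m.+1%:R) ?ltr_pdivlMr//.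
by rewrite -[in RHS](@natr1 _ (a i)) mulrDl mul1r mulrC.
Qed.

Lemma stepE m g x (k : grid m) : cell k x -> step m g x = g (node k).
Proof.
move=> xk; rewrite /step (bigD1 k)//= indicE mem_set// mulr1 big1 ?addr0// => l lk.
rewrite indicE memNset ?mulr0// => xl; move: lk; rewrite (cell_inj xl xk).
by rewrite eqxx.
Qed.

Lemma measurable_step m g : measurable_fun setT (step m g).
Proof.
apply: measurable_sum => k; apply: measurable_funM => //.
by apply: measurable_indic; exact: measurable_cell.
Qed.

Lemma Rintegral_step m g : \int[mu]_(x in box) step m g x = riemann_sum m g.
Proof.
have mQ := measurable_box.
have ind k : mu.-integrable box (EFin \o (\1_(@cell m k) : E -> R)).
  apply: (bounded_fun_integrable mQ box_finite (C := 1)).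
    by apply: measurable_funTS; apply: measurable_indic; exact: measurable_cell.
  by move=> x _; rewrite indicE; case: (_ \in _); rewrite ?normr1 ?normr0.
rewrite Rintegral_sum//; last by move=> k; exact: (integrableZR mQ).
rewrite /riemann_sum mulr_sumr; apply: eq_bigr => k _.
rewrite RintegralZl// mulrC; congr (_ * _).
rewrite /Rintegral integral_indic//; last exact: measurable_cell.
rewrite (setIidl (@cell_sub_box m k)); exact: (congr1 fine (@lebesgue_rV_cell m k)).
Qed.

(** A Riemann sum is the integral of a step function, so the convergence is an
    instance of dominated convergence. *)
Lemma riemann_sum_cvg (g_ : nat -> E -> R) (g : E -> R) (C : R) :
  (forall m x, `|g_ m x| <= C) ->
  (forall (x : E) (e : R), box x -> 0 < e -> \forall m \near \oo,
     forall y : E, (forall i, `|x ord0 i - y ord0 i| <= mesh m) -> `|g x - g_ m y| <= e) ->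
  riemann_sum m (g_ m) @[m --> \oo] --> \int[mu]_(x in box) g x.
Proof.
move=> gC cg.
under eq_cvg do rewrite -Rintegral_step.
apply: (bounded_cvg_Rintegral measurable_box box_finite (C := C)).
- by move=> m; apply: measurable_funTS; exact: measurable_step.
- by move=> m x /(boxP m)[k xk]; rewrite (stepE _ xk).
move=> x xQ; apply/cvgrPdist_le => e e0; have := cg _ _ xQ e0.
apply: filterS => m h; have [k xk] := boxP m xQ; rewrite (stepE _ xk); apply: h => i.
have := xk i; rewrite /= in_itv /= => /andP[h1 h2].
by rewrite ger0_norm ?subr_ge0// lerBlDl ltW.
Qed.

End riemann_sums.

(** * Bounds on the sine *)

Section sine_bounds.
Context (R : realType).
Implicit Types t x y : R.

Lemma lipschitz_of_derivative (f df : R -> R) x y :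
  (forall t, is_derive t (1 : R) f (df t)) -> (forall t, `|df t| <= 1) ->
  `|f x - f y| <= `|x - y|.
Proof.
move=> dF df1; wlog xy : x y / y <= x => [h|].
  by have [/h//|/ltW/h] := leP y x; rewrite distrC [`|y - x|]distrC.
have cf : {within `[y, x], continuous f}.
  apply: continuous_subspaceT => t; apply: differentiable_continuous.
  by apply/derivable1_diffP; exact: ex_derive.
have [c _ ->] := MVT_segment xy (fun t _ => dF t) cf.
by rewrite normrM ler_piMl.
Qed.

Lemma sin_lipschitz x y : `|sin x - sin y| <= `|x - y|.
Proof. by apply: lipschitz_of_derivative => t; exact: cos_max. Qed.

Lemma cos_lipschitz x y : `|cos x - cos y| <= `|x - y|.
Proof. by apply: lipschitz_of_derivative => t; rewrite normrN; exact: sin_max. Qed.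

Lemma sin_norm_le t : `|sin t| <= `|t|.
Proof. by have := sin_lipschitz t 0; rewrite sin0 !subr0. Qed.

Lemma cvg_sin_over : sin t / t @[t --> (0 : R)^'] --> (1 : R).
Proof.
have d : derivable sin (0 : R) (1 : R) by [].
have -> : (1 : R) = 'D_1 sin (0 : R) by rewrite (@derive_val _ _ _ _ _ sin (cos 0)) cos0.
rewrite /derive (_ : (fun t => sin t / t) = (fun h : R => h^-1 *: ((sin \o shift 0) (h *: 1) - sin 0))) //.
by apply/funext => t; rewrite /= sin0 subr0 addr0 /GRing.scale/= mulr1 mulrC.
Qed.

(** With [h_ m] half the mesh, this is the convergence of the symbol of the
    difference quotient in one variable to that of the derivative. *)
Lemma cvg_sin_div x (h_ : nat -> R) : (forall m, h_ m != 0) -> h_ m @[m --> \oo] --> 0 ->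
  sin (h_ m * x) / h_ m @[m --> \oo] --> x.
Proof.
move=> h0 hc; have [->|x0] := eqVneq x 0.
  by under eq_cvg do rewrite mulr0 sin0 mul0r; exact: cvg_cst.
have := (cvgr_dnbhsP _ _ _).1 cvg_sin_over (fun m => h_ m * x).
have hx m : h_ m * x != 0 by rewrite mulf_neq0.
have cx : h_ m * x @[m --> \oo] --> 0.
  by rewrite -[X in _ --> X](mul0r x); apply: cvgM => //; exact: cvg_cst.
move=> /(_ (conj hx cx)) h.
rewrite -[X in _ --> X](mul1r x).
rewrite (_ : (fun m => _) = (fun m => sin (h_ m * x) / (h_ m * x) * x)).
  by apply: cvgM => //; exact: cvg_cst.
by apply/funext => m; field; rewrite x0 h0.
Qed.

(** Near the origin [sin t / t] is close to 1; away from it [sin] is bounded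
    below by monotonicity. *)
Lemma sin_norm_ge : exists2 kappa : R, 0 < kappa <= 2^-1 &
  forall t, `|t| <= pi / 2 -> kappa * `|t| <= `|sin t|.
Proof.
have pi0 := @pi_gt0 R.
have [d /= d0 dP] : exists2 d : R, 0 < d & forall t, `|t| < d -> t != 0 -> 2^-1 < sin t / t.
  have /cvgr_gt/(_ 2^-1) := cvg_sin_over.
  have /[swap]/[apply] : (2^-1 : R) < 1 by rewrite invf_lt1// ltr1n.
  move=> /nbhs_ballP [d /= d0 dP]; exists d => // t td t0.
  by apply: dP => //; rewrite -ball_normE/= sub0r normrN.
pose e := Num.min (d / 2) (pi / 2).
have e0 : 0 < e by rewrite lt_min !divr_gt0.
have ed : e <= d / 2 by rewrite ge_min lexx.
have ep : e <= pi / 2 by rewrite ge_min lexx orbT.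
have se0 : 0 < sin e by apply: sin_gt0_pi; rewrite e0 /=; lra.
pose kappa := Num.min (2^-1) (sin e / (pi / 2)).
have k1 : kappa <= 2^-1 by rewrite ge_min lexx.
have k2 : kappa <= sin e / (pi / 2) by rewrite ge_min lexx orbT.
have k0 : 0 < kappa by rewrite lt_min invr_gt0 ltr0n/= divr_gt0// divr_gt0.
exists kappa; first by rewrite k0.
move=> t; wlog t0 : t / 0 <= t => [h tp|tp].
  have [/h->//|/ltW t0] := leP 0 t.
  by rewrite -normrN -[leRHS]normrN -sinN; apply: h; rewrite ?oppr_ge0// normrN.
rewrite ger0_norm// in tp *.
apply: (le_trans _ (ler_norm _)).
have [te|te] := ltP t e.
  have [->|tn0] := eqVneq t 0; first by rewrite mulr0 sin0.
  have t1 : 0 < t by rewrite lt_neqAle eq_sym tn0.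
  have td : `|t| < d by rewrite ger0_norm//; lra.
  have := dP t td tn0; rewrite ltr_pdivlMr// => /ltW; apply: le_trans.
  by rewrite ler_pM2r.
have st : sin e <= sin t.
  have [->//|et] := eqVneq e t.
  apply/ltW; rewrite ltr_sin ?in_itv/=; [by rewrite lt_neqAle et|apply/andP; split; lra|apply/andP; split; lra].
apply: (le_trans _ st).
move: k2; rewrite ler_pdivlMr ?divr_gt0// => k2; apply: le_trans k2.
by rewrite ler_pM2l.
Qed.

End sine_bounds.

(** * Parseval's identity on a lattice *)

Section lattice_parseval.
Context (R : realType) (n : nat).
Local Notation E := 'rV[R]_n.
Local Notation mu := (@lebesgue_rV R n).
Variables (D : nat) (phi : E -> R).
Hypothesis phi_supp : forall (x : E) i, D%:R - 1 <= `|x ord0 i| -> phi x = 0.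
Variable m : nat.

Local Notation h := (mesh R m).
Local Notation p := (@node R n D m).

Definition dquot i (y : E) : R := (phi (y + h *: delta_mx ord0 i) - phi y) / h.
Definition lattice_coef (k : grid n D m) : R := h ^+ n * phi (p k).
Definition lattice_spectrum : E -> R := spectrum p lattice_coef.
(** The Fourier multiplier of the discrete Laplacian of mesh [h]: the squared
    modulus of [(exp (i h x_i) - 1) / h], summed over the coordinates. *)
Definition lattice_symbol (x : E) : R := \sum_i (sin (h / 2 * x ord0 i) / (h / 2)) ^+ 2.

Let h0 : 0 < h := mesh_gt0 R m.
Let L := pi / h.
Let L0 : 0 < L. Proof. by rewrite divr_gt0// pi_gt0. Qed.

Let node_inj : injective p.
Proof.
move=> k l kl; apply/ffunP => i; apply/val_inj; apply/eqP.
move/rowP : kl => /(_ i); rewrite !mxE => /addrI/mulfI => /(_ (lt0r_neq0 h0)) /eqP.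
by rewrite eqr_nat.
Qed.

Let node_dual k l i : exists j : int, (p k - p l) ord0 i * L = j%:~R * pi.
Proof.
exists ((k i)%:Z - (l i)%:Z); rewrite !mxE /L intrB -!pmulrn.
by field; rewrite lt0r_neq0.
Qed.

Let scaling (f : E -> R) :
  (2 * L) ^+ n * (\sum_k (h ^+ n * f (p k)) ^+ 2) = (2 * pi) ^+ n * riemann_sum D m (fun x => f x ^+ 2).
Proof.
rewrite /riemann_sum mulrA -exprMn.
have -> : 2 * pi * h = (2 * L) * (h ^+ 2) by rewrite /L; field; rewrite lt0r_neq0.
rewrite [RHS](_ : _ = (2 * L) ^+ n * ((h ^+ 2) ^+ n * \sum_k f (p k) ^+ 2)); last by rewrite exprMn mulrA.
congr (_ * _); rewrite mulr_sumr; apply: eq_bigr => k _.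
by rewrite exprMn -!exprM mulnC.
Qed.

Lemma Rintegral_lattice_spectrum :
  \int[mu]_(x in cube L) lattice_spectrum x = (2 * pi) ^+ n * riemann_sum D m (fun x => phi x ^+ 2).
Proof. by rewrite (Rintegral_spectrum _ L0 node_inj node_dual) scaling. Qed.

Let tau i (k : grid n D m) : grid n D m := [ffun j => if j == i then ordS (k j) else k j].

Let tau_inj i : injective (tau i).
Proof.
move=> k l kl; apply/ffunP => j; have /ffunP/(_ j) := kl; rewrite !ffunE.
by case: ifP => // _ /ordS_inj.
Qed.

(* The cyclic shift agrees with the translation except across the face of the
   box, where the function vanishes. *)
Let node_tau i (k : grid n D m) : (k i).+1 != (2 * D * m.+1)%N ->
  p (tau i k) = p k + h *: delta_mx ord0 i.
Proof.
move=> ki; apply/rowP => j; rewrite !mxE ffunE eqxx /= eq_sym.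
case: (eqVneq i j) => [<-|ij]; last by rewrite mulr0 addr0.
rewrite mulr1 /= modn_small; last by rewrite ltn_neqAle ki ltn_ord.
by rewrite -natr1 mulrDr mulr1 addrA.
Qed.

Let phi_tau i (k : grid n D m) : phi (p (tau i k)) = phi (p k + h *: delta_mx ord0 i).
Proof.
have [ki|ki] := eqVneq ((k i).+1) (2 * D * m.+1)%N; last by rewrite node_tau.
rewrite !(@phi_supp _ i)//.
  rewrite !mxE !eqxx /= mulr1 -addrA -[X in _ + (_ + X)]mulr1 -mulrDr natr1 ki.
  rewrite (_ : - D%:R + _ = D%:R); first by rewrite ger0_norm// lerBlDr lerDl.
  rewrite mulrC natrM mulfK// natrM mulr_natl mulr2n; ring.
rewrite !mxE ffunE eqxx /= ki modnn mulr0 addr0 normrN ger0_norm//.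
by rewrite lerBlDr lerDl.
Qed.

(** The difference quotient is a difference along a cyclic shift of the grid,
    hence acts on the trigonometric polynomial as a multiplier. *)
Lemma Rintegral_lattice_dquot i :
  \int[mu]_(x in cube L) ((sin (h / 2 * x ord0 i) / (h / 2)) ^+ 2 * lattice_spectrum x) =
  (2 * pi) ^+ n * riemann_sum D m (fun x => dquot i x ^+ 2).
Proof.
rewrite -scaling -(Rintegral_spectrum _ L0 node_inj node_dual).
apply: eq_Rintegral => x _.
have -> : (fun k => h ^+ n * dquot i (p k)) =
    (fun k => (fun k => h^-1 * lattice_coef k) (tau i k) - h^-1 * lattice_coef k).
  by apply/funext => k; rewrite /lattice_coef phi_tau /dquot; ring.
rewrite (spectrum_diff (c := fun k => h^-1 * lattice_coef k) (v := h *: delta_mx ord0 i) x (@tau_inj i)); last first.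
  move=> k; rewrite /lattice_coef => ck; apply: node_tau.
  apply: contra ck => /eqP ki; rewrite (@phi_supp _ i) ?mulr0//.
  rewrite !mxE ffunE eqxx /= ki modnn mulr0 addr0 normrN ger0_norm//.
  by rewrite lerBlDr lerDl.
have -> : dot (h *: delta_mx ord0 i) x = (h / 2 * x ord0 i) *+ 2.
  rewrite /dot (bigD1 i)//= !mxE !eqxx big1 ?addr0; last first.
    by move=> j ji; rewrite !mxE (negPf ji) andbF mulr0 mul0r.
  by rewrite /= mulr1 -mulr_natr; field.
have -> c : spectrum p (fun k => h^-1 * c k) x = h ^- 2 * spectrum p c x.
  rewrite /spectrum /cos_sum /sin_sum.
  under eq_bigr do rewrite -mulrA.
  under [X in _ + X ^+ 2]eq_bigr do rewrite -mulrA.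
  by rewrite -!mulr_sumr !exprMn exprVn mulrDr.
rewrite cos_mulr2n cos2sin2 -/lattice_spectrum.
by set s := sin _; field; rewrite lt0r_neq0.
Qed.

Lemma measurable_lattice_symbol : measurable_fun setT lattice_symbol.
Proof.
apply: measurable_sum => i; apply: measurable_funX; apply: measurable_funM => //.
apply: measurableT_comp; first by apply: continuous_measurable_fun; exact: continuous_sin.
by apply: measurable_funM => //; exact: measurable_coord.
Qed.

Lemma lattice_symbol_le x : 0 <= lattice_symbol x <= sqnorm x.
Proof.
apply/andP; split; first by apply: sumr_ge0 => i _; exact: sqr_ge0.
apply: ler_sum => i _; rewrite -[leRHS]real_normK ?num_real// -[leLHS]real_normK ?num_real//.
rewrite lerXn2r ?nnegrE// normrM normfV.
have h20 : 0 < `|h / 2| by rewrite normr_gt0 mulf_neq0// ?lt0r_neq0// invr_gt0.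
by rewrite ler_pdivrMr// mulrC -normrM mulrC sin_norm_le.
Qed.

Let integrable_bdd (f : E -> R) (C : R) : measurable_fun setT f ->
  (forall x, `|f x| <= C) -> mu.-integrable (cube L) (EFin \o f).
Proof.
move=> mf fC; apply: (bounded_fun_integrable (@measurable_cube R n L) (cube_finite n (ltW L0)) (C := C)) => //.
exact: measurable_funTS.
Qed.

Lemma lattice_spectrum_le x : `|lattice_spectrum x| <= 2 * (\sum_k `|lattice_coef k|) ^+ 2.
Proof. by rewrite ger0_norm ?spectrum_ge0//; exact: spectrum_le. Qed.

Let integrable_spectrum : mu.-integrable (cube L) (EFin \o lattice_spectrum).
Proof. exact: integrable_bdd (measurable_spectrum _ _) lattice_spectrum_le. Qed.

Let integrable_dquot i : mu.-integrable (cube L)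
  (EFin \o (fun x : E => (sin (h / 2 * x ord0 i) / (h / 2)) ^+ 2 * lattice_spectrum x)).
Proof.
apply: (@integrable_bdd _ ((h / 2) ^- 2 * (2 * (\sum_k `|lattice_coef k|) ^+ 2))).
  apply: measurable_funM; last exact: measurable_spectrum.
  apply: measurable_funX; apply: measurable_funM => //.
  apply: measurableT_comp; first by apply: continuous_measurable_fun; exact: continuous_sin.
  by apply: measurable_funM => //; exact: measurable_coord.
move=> x; rewrite normrM; apply: ler_pM => //; last exact: lattice_spectrum_le.
have h20 : 0 < h / 2 by rewrite divr_gt0.
rewrite expr_div_n normrM ger0_norm ?sqr_ge0// ger0_norm ?invr_ge0 ?sqr_ge0//.
rewrite ler_piMl ?invr_ge0 ?sqr_ge0//.
Qed.

(** The exact discrete form of Plancherel's identity for a function and its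
    gradient; the Fourier integrals of the continuum are limits of both sides. *)
Lemma Rintegral_lattice_energy (z : R) :
  \int[mu]_(x in cube L) ((z - lattice_symbol x) * lattice_spectrum x) =
  (2 * pi) ^+ n * (z * riemann_sum D m (fun x => phi x ^+ 2) -
                   \sum_i riemann_sum D m (fun x => dquot i x ^+ 2)).
Proof.
have mL := @measurable_cube R n L.
transitivity (\int[mu]_(x in cube L) (z * lattice_spectrum x -
   \sum_i ((sin (h / 2 * x ord0 i) / (h / 2)) ^+ 2 * lattice_spectrum x))).
  by apply: eq_Rintegral => x _; rewrite mulrBl mulr_suml.
rewrite RintegralB//; [|exact: (integrableZR mL)|exact: (integrable_sumR mL)].
rewrite RintegralZl// Rintegral_lattice_spectrum Rintegral_sum//.
rewrite mulrBr mulr_sumr mulrCA; congr (_ - _); apply: eq_bigr => i _.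
exact: Rintegral_lattice_dquot.
Qed.

End lattice_parseval.

(** * From the lattice to the continuum *)


Lemma le_Rintegral_subset d (T : measurableType d) (R : realType)
    (mu : {measure set T -> \bar R}) (A B : set T) (f : T -> R) :
  measurable A -> measurable B -> B `<=` A -> mu.-integrable A (EFin \o f) ->
  (forall x, A x -> ~ B x -> f x <= 0) ->
  \int[mu]_(x in A) f x <= \int[mu]_(x in B) f x.
Proof.
move=> mA mB BA fi f0; have mAB : measurable (A `\` B) by exact: measurableD.
have ABE : A = B `|` (A `\` B) by rewrite setDUK.
rewrite [X in \int[_]_(_ in X) _]ABE Rintegral_setU//; last 2 first.
- by rewrite -ABE.
- by apply/disj_setPS => x [Bx [_ /(_ Bx)]].
rewrite gerDl.
have := @le_Rintegral _ _ _ mu _ f (fun=> 0) mAB.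
rewrite [X in _ <= X]Rintegral_cst// mul0r; apply.
- by apply: (integrableS mA).
- exact: integrable0.
- by move=> x [Ax Bx]; exact: f0.
Qed.

Lemma cvg_sumR (R : realType) (T : Type) (F : set_system T) {FF : Filter F} (I : Type)
    (s : seq I) (f : I -> T -> R) (l : I -> R) :
  (forall i, f i x @[x --> F] --> l i) ->
  \sum_(i <- s) f i x @[x --> F] --> \sum_(i <- s) l i.
Proof.
move=> fl; elim: s => [|i s IH].
  by rewrite big_nil; under eq_cvg do rewrite big_nil; exact: cvg_cst.
by rewrite big_cons; under eq_cvg do rewrite big_cons; exact: cvgD.
Qed.

Section continuity.
Context (R : realType) (n : nat).
Local Notation E := 'rV[R]_n.

Lemma mesh_cvg0 : mesh R m @[m --> \oo] --> 0.
Proof. exact: cvg_harmonic. Qed.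

Lemma continuous_coord_dist (g : E -> R) (x : E) (e : R) : {for x, continuous g} -> 0 < e ->
  exists2 d : R, 0 < d & forall y : E, (forall i, `|x ord0 i - y ord0 i| <= d) -> `|g x - g y| <= e.
Proof.
move=> /cvgrPdist_le/(_ e) cg e0.
have /nbhs_ballP[d /= d0 dP] := cg e0.
exists (d / 2); first by rewrite divr_gt0.
move=> y xy; apply: dP; rewrite -ball_normE /=.
apply: rV_norm_lt => // i; rewrite !mxE; apply: (le_lt_trans (xy i)); lra.
Qed.

Lemma continuous_dot (a : E) : continuous (fun x : E => dot x a).
Proof.
move=> x; apply: (cvg_sumR (F := nbhs x)) => i; apply: cvgM; last exact: cvg_cst.
exact: coord_continuous.
Qed.

End continuity.

Section lattice_limit.
Context (R : realType) (n : nat).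
Local Notation E := 'rV[R]_n.
Local Notation mu := (@lebesgue_rV R n).

Definition cosd (xi x : E) : R := cos (dot x xi).
Definition sind (xi x : E) : R := sin (dot x xi).
(** The squared modulus of the Fourier transform of [u] restricted to [A]. *)
Definition power_spectrum (A : set E) (u : E -> R) (xi : E) : R :=
  ip mu A u (cosd xi) ^+ 2 + ip mu A u (sind xi) ^+ 2.

Lemma continuous_cosd xi : continuous (cosd xi).
Proof.
move=> x; have h := @continuous_cos R (dot x xi).
exact: (continuous_comp (@continuous_dot R n xi x) h).
Qed.

Lemma continuous_sind xi : continuous (sind xi).
Proof.
move=> x; have h := @continuous_sin R (dot x xi).
exact: (continuous_comp (@continuous_dot R n xi x) h).
Qed.

Variables (D : nat) (phi : E -> R) (C : R).
Hypothesis dphi : forall i x, derivable phi x (delta_mx ord0 i).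
Hypothesis cdphi : forall i, continuous (partial i phi).
Hypothesis phiC : forall x, `|phi x| <= C.
Hypothesis dphiC : forall i x, `|partial i phi x| <= C.

Let C0 : 0 <= C. Proof. exact: le_trans (phiC 0). Qed.

(** The mean value theorem; it makes the difference quotients converge to the
    derivative uniformly near each point, as Riemann sums require. *)
Lemma dquot_mvt m i (y : E) : exists2 t : R, 0 <= t <= mesh R m &
  dquot phi m i y = partial i phi (y + t *: delta_mx ord0 i).
Proof.
have h0 := mesh_gt0 R m; pose e : E := delta_mx ord0 i.
pose g (t : R) := phi (y + t *: e).
have dg (t : R) : is_derive t (1 : R) g (partial i phi (y + t *: e)).
  have := @dphi i (y + t *: e); rewrite /derivable /partial /derive /=.
  set F := (fun s : R => _) => dF.
  have E0 : (fun s : R => s^-1 *: ((g \o shift t) (s *: (1 : R)) - g t)) = F.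
    apply/funext => s; rewrite /F /g /= [s *: 1]mulr1; congr (_ *: (phi _ - _)).
    by rewrite scalerDl addrCA addrA.
  by apply: DeriveDef; rewrite /derivable /derive E0.
have cg : {within `[0, mesh R m], continuous g}.
  apply: continuous_subspaceT => t; apply: differentiable_continuous.
  by apply/derivable1_diffP; apply: ex_derive.
have [c cI] := MVT_segment (ltW h0) (fun t _ => dg t) cg.
rewrite subr0 => gE; exists c; first by move: cI; rewrite in_itv.
rewrite /dquot; move: gE; rewrite /g scale0r addr0 => ->.
by rewrite mulfK// lt0r_neq0.
Qed.

Lemma dquot_le m i (y : E) : `|dquot phi m i y| <= C.
Proof. by have [t _ ->] := dquot_mvt m i y; exact: dphiC. Qed.

Lemma riemann_sum_cvg_continuous (g : E -> R) (K : R) : continuous g -> (forall x, `|g x| <= K) ->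
  riemann_sum D m g @[m --> \oo] --> \int[mu]_(x in @box R n D) g x.
Proof.
move=> cg gK; apply: (riemann_sum_cvg (g_ := fun=> g) (C := K)) => // x e _ e0.
have [d d0 dP] := continuous_coord_dist (cg x) e0.
have /cvgr_le/(_ _ d0) := @mesh_cvg0 R.
by apply: filterS => m md y xy; apply: dP => i; apply: le_trans (xy i) md.
Qed.

Lemma riemann_sum_cvg_dquot i : riemann_sum D m (fun x => dquot phi m i x ^+ 2) @[m --> \oo] -->
  \int[mu]_(x in @box R n D) (partial i phi x ^+ 2).
Proof.
apply: (riemann_sum_cvg (g_ := fun m x => dquot phi m i x ^+ 2) (C := C ^+ 2)).
  by move=> m x; rewrite normrX lerXn2r ?nnegrE// dquot_le.
move=> x e _ e0.
have e1 : 0 < e / (2 * C + 1) by rewrite divr_gt0// ltr_wpDl// mulr_ge0.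
have [d d0 dP] := continuous_coord_dist (@cdphi i x) e1.
have d2 : 0 < d / 2 by rewrite divr_gt0.
have /cvgr_le/(_ _ d2) := @mesh_cvg0 R.
apply: filterS => m md y xy; have [t /andP[t0 tm] ->] := dquot_mvt m i y.
set a := partial i phi x; set b := partial i phi _.
have ab : `|a - b| <= e / (2 * C + 1).
  apply: dP => j; rewrite !mxE opprD addrA (le_trans (ler_normB _ _))//.
  rewrite (splitr d) lerD//; first exact: le_trans (xy j) md.
  rewrite eqxx /= normrM ger0_norm// (le_trans _ (le_trans tm md))// ler_piMr//.
  by case: (_ == _); rewrite ?normr0 ?normr1.
rewrite subr_sqr normrM.
have abC : `|a + b| <= 2 * C.
  by rewrite (le_trans (ler_normD _ _))// mulr_natl mulr2n lerD// dphiC.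
apply: (le_trans (ler_pM _ _ ab abC)) => //.
rewrite -mulrA; apply: ler_piMr; first exact: ltW.
by rewrite mulrC ler_pdivrMr ?ltr_wpDl ?mulr_ge0// mul1r lerDl.
Qed.

End lattice_limit.

Section energy_inequality.
Context (R : realType) (n : nat).
Local Notation E := 'rV[R]_n.
Local Notation mu := (@lebesgue_rV R n).

Variables (D : nat) (phi : E -> R) (C : R).
Hypothesis phi_supp : forall (x : E) i, D%:R - 1 <= `|x ord0 i| -> phi x = 0.
Hypothesis cphi : continuous phi.
Hypothesis dphi : forall i x, derivable phi x (delta_mx ord0 i).
Hypothesis cdphi : forall i, continuous (partial i phi).
Hypothesis phiC : forall x, `|phi x| <= C.
Hypothesis dphiC : forall i x, `|partial i phi x| <= C.

Local Notation Q := (@box R n D).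
Local Notation P m := (@lattice_spectrum R n D phi m).

Lemma sum_lattice_coef m : \sum_k `|@lattice_coef R n D phi m k| <= (2 * D%:R) ^+ n * C.
Proof.
have h0 := mesh_gt0 R m.
apply: (@le_trans _ _ (\sum_(k : grid n D m) mesh R m ^+ n * C)).
  apply: ler_sum => k _; rewrite normrM ger0_norm; last by rewrite exprn_ge0// ltW.
  by rewrite ler_pM2l ?exprn_gt0.
rewrite sumr_const card_ffun !card_ord -[leLHS]mulr_natl natrX mulrA -exprMn /mesh !natrM mulfK//.
Qed.

Lemma lattice_spectrum_bound m x : `|P m x| <= 2 * ((2 * D%:R) ^+ n * C) ^+ 2.
Proof.
apply: le_trans (@lattice_spectrum_le R n D phi m x) _; apply: ler_wpM2l => //; rewrite lerXn2r ?nnegrE ?sumr_ge0//.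
  exact: le_trans (sumr_ge0 _ _) (sum_lattice_coef m).
exact: sum_lattice_coef.
Qed.

Lemma power_spectrum_cvg xi : P m xi @[m --> \oo] --> power_spectrum Q phi xi.
Proof.
have cs (f : E -> R) : continuous f -> (forall x, `|f x| <= 1) ->
    riemann_sum D m (fun x => phi x * f x) @[m --> \oo] --> ip mu Q phi f.
  move=> cf f1; apply: (riemann_sum_cvg_continuous (K := C)).
    move=> x; exact: (cvgM (@cphi x) (cf x)).
  by move=> x; rewrite normrM -[leRHS]mulr1; apply: ler_pM.
have cosE m : cos_sum (@node R n D m) (@lattice_coef R n D phi m) xi =
    riemann_sum D m (fun x => phi x * cosd xi x).
  by rewrite /riemann_sum mulr_sumr; apply: eq_bigr => k _; rewrite mulrA.
have sinE m : sin_sum (@node R n D m) (@lattice_coef R n D phi m) xi =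
    riemann_sum D m (fun x => phi x * sind xi x).
  by rewrite /riemann_sum mulr_sumr; apply: eq_bigr => k _; rewrite mulrA.
rewrite /lattice_spectrum /spectrum.
under eq_cvg do rewrite cosE sinE !expr2.
rewrite /power_spectrum !expr2.
have c1 := cs _ (@continuous_cosd R n xi) (fun x => cos_max _).
have c2 := cs _ (@continuous_sind R n xi) (fun x => sin_max _).
by apply: cvgD; apply: cvgM.
Qed.

Lemma lattice_symbol_cvg (xi : E) : @lattice_symbol R n m xi @[m --> \oo] --> sqnorm xi.
Proof.
apply: (cvg_sumR (F := \oo)) => i.
have hc : mesh R m / 2 @[m --> \oo] --> 0.
  by rewrite -[X in _ --> X](mul0r 2^-1); apply: cvgM; [exact: mesh_cvg0|exact: cvg_cst].
have h0 m : mesh R m / 2 != 0 by rewrite mulf_neq0// ?lt0r_neq0 ?mesh_gt0.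
have c := @cvg_sin_div R (xi ord0 i) _ h0 hc.
by under eq_cvg do rewrite expr2; rewrite expr2; apply: cvgM.
Qed.

Lemma measurable_power_spectrum_box : measurable_fun setT (power_spectrum Q phi).
Proof.
apply: (measurable_realfun.measurable_fun_cvg (h := fun m => P m)).
  by move=> m; exact: measurable_spectrum.
by move=> x _; exact: power_spectrum_cvg.
Qed.

(** Off the ball of radius [rho] the discrete symbol exceeds [z], so that
    dropping the rest of the dual cell can only increase the integral; the
    remaining domain is fixed and the mesh can be sent to 0. *)
Lemma energy_inequality (kappa z rho : R) : 0 < kappa ->
  (forall t : R, `|t| <= pi / 2 -> kappa * `|t| <= `|sin t|) ->
  0 <= z -> 0 < rho -> z <= kappa ^+ 2 * rho ^+ 2 ->
  (2 * pi) ^+ n * (z * \int[mu]_(x in Q) (phi x ^+ 2)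
                   - \sum_i \int[mu]_(x in Q) (partial i phi x ^+ 2)) <=
  \int[mu]_(xi in [set xi | sqnorm xi < rho ^+ 2]) ((z - sqnorm xi) * power_spectrum Q phi xi).
Proof.
move=> k0 kP z0 rho0 zrho; set B := [set xi : E | _].
have mB : measurable B by exact: measurable_sqnorm_lt.
have pi0 := @pi_gt0 R.
have Boo : (mu B < +oo)%E.
  by apply: (sub_cube_finite mB _ (@sqnorm_lt_cube R n rho)).
pose K := 2 * ((2 * D%:R) ^+ n * C) ^+ 2.
have lhs : (2 * pi) ^+ n * (z * riemann_sum D m (fun x => phi x ^+ 2) -
      \sum_i riemann_sum D m (fun x => dquot phi m i x ^+ 2)) @[m --> \oo] -->
    (2 * pi) ^+ n * (z * \int[mu]_(x in Q) (phi x ^+ 2)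
                   - \sum_i \int[mu]_(x in Q) (partial i phi x ^+ 2)).
  apply: cvgM; first exact: cvg_cst.
  apply: cvgB.
    apply: cvgM; first exact: cvg_cst.
    apply: (riemann_sum_cvg_continuous (K := C ^+ 2)).
      by move=> x; exact: (cvgM (@cphi x) (@cphi x)).
    by move=> x; rewrite normrX lerXn2r ?nnegrE// (le_trans _ (phiC x)).
  apply: (cvg_sumR (F := \oo)) => i; exact: (riemann_sum_cvg_dquot dphi cdphi phiC dphiC).
have rhs : \int[mu]_(xi in B) ((z - lattice_symbol m xi) * P m xi) @[m --> \oo] -->
    \int[mu]_(xi in B) ((z - sqnorm xi) * power_spectrum Q phi xi).
  apply: (bounded_cvg_Rintegral mB Boo (C := (z + rho ^+ 2) * K)).
  - move=> m; apply: measurable_funTS; apply: measurable_funM; last exact: measurable_spectrum.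
    by apply: measurable_funB => //; exact: measurable_lattice_symbol.
  - move=> m x Bx; rewrite normrM; apply: ler_pM => //; last exact: lattice_spectrum_bound.
    have /andP[s0 s1] := @lattice_symbol_le R n m x.
    have Bx' : sqnorm x < rho ^+ 2 by []; rewrite ler_norml; apply/andP; split; lra.
  - move=> x _; apply: cvgM; last exact: power_spectrum_cvg.
    by apply: cvgB; [exact: cvg_cst|exact: lattice_symbol_cvg].
apply: (ler_cvg_to lhs rhs).
have r0 : 0 < pi / rho by rewrite divr_gt0.
have /cvgr_le/(_ _ r0) := @mesh_cvg0 R.
apply: filterS => m mr; have h0 := mesh_gt0 R m.
have BL : B `<=` cube (pi / mesh R m).
  move=> x /sqnorm_lt_cube/cubeP xr; apply/cubeP => i; apply: (le_trans (xr i)).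
  by rewrite gtr0_norm// ler_pdivlMr// mulrC -ler_pdivlMr.
rewrite -(Rintegral_lattice_energy phi_supp).
have Lpos : 0 <= pi / mesh R m by rewrite divr_ge0// ltW.
apply: le_Rintegral_subset => //; first exact: measurable_cube.
  apply: (bounded_fun_integrable (@measurable_cube R n _) (cube_finite n Lpos)
    (C := (z + n%:R * (pi / mesh R m) ^+ 2) * K)).
    apply: measurable_funTS; apply: measurable_funM; last exact: measurable_spectrum.
    by apply: measurable_funB => //; exact: measurable_lattice_symbol.
  move=> x /cubeP xL; rewrite normrM; apply: ler_pM => //; last exact: lattice_spectrum_bound.
  have /andP[s0 s1] := @lattice_symbol_le R n m x.
  have sL : sqnorm x <= n%:R * (pi / mesh R m) ^+ 2.
    apply: (@le_trans _ _ (\sum_(i < n) (pi / mesh R m) ^+ 2)).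
      apply: ler_sum => i _; rewrite -[leLHS]real_normK ?num_real//.
      by rewrite lerXn2r ?nnegrE.
    by rewrite sumr_const card_ord mulr_natl.
  rewrite ler_norml; apply/andP; split; lra.
move=> x /cubeP xL xB; apply: mulr_le0_ge0; last exact: spectrum_ge0.
rewrite subr_le0 (le_trans zrho)//.
apply: (@le_trans _ _ (kappa ^+ 2 * sqnorm x)).
  by rewrite ler_pM2l ?exprn_gt0// leNgt; apply/negP.
rewrite mulr_sumr; apply: ler_sum => i _.
have h20 : 0 < mesh R m / 2 by rewrite divr_gt0.
rewrite -exprMn -[leLHS]real_normK ?num_real// -[leRHS]real_normK ?num_real//.
rewrite lerXn2r ?nnegrE// [leRHS]normrM normfV [`|mesh R m / 2|]gtr0_norm// ler_pdivlMr//.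
rewrite normrM gtr0_norm//.
have xE : `|mesh R m / 2 * x ord0 i| = `|x ord0 i| * (mesh R m / 2).
  by rewrite normrM gtr0_norm// mulrC.
rewrite -[leLHS]mulrA -xE; apply: kP; rewrite xE.
rewrite mulrA ler_pM2r ?invr_gt0//.
by rewrite -ler_pdivlMr// xL.
Qed.

End energy_inequality.

(** * Spectral densities of Sobolev functions *)

Section sobolev.
Context (R : realType) (n : nat).
Local Notation E := 'rV[R]_n.
Local Notation mu := (@lebesgue_rV R n).
Variable Omega : set E.
Hypothesis mOmega : measurable Omega.

Local Notation innerO := (ip mu Omega).

Lemma innerE u v : inner Omega u v = innerO u v. Proof. by []. Qed.

Lemma L2_sqint (u : E -> R) : L2 Omega u -> sqint mu Omega u.
Proof.
move=> L2u; have i2 := Lfun2_integrable_sqr L2u.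
have mu_ : measurable_fun setT (u \_ Omega).
  by move: L2u; rewrite /L2 inE => /andP[]; rewrite inE.
split; first exact/measurable_restrictT.
apply/integrable_mkcond => //; move: i2; congr (_.-integrable _ _).
by apply/funext => x; rewrite /= !patchE; case: ifPn => //= _; rewrite expr0n.
Qed.

(** Translates the extended-real norm of the definitions of the Sobolev spaces
    into the real inner product, where polarization is available. *)
Lemma Lnorm2_ip (u : E -> R) : sqint mu Omega u ->
  ('N[mu]_2%:E[EFin \o (u \_ Omega)] = (Num.sqrt (innerO u u))%:E)%E.
Proof.
move=> [mu_ iu]; rewrite unlock /=.
have -> : (\int[mu]_x (`|(u \_ Omega) x|%:E `^ 2) = (innerO u u)%:E)%E.
  rewrite /ip /Rintegral fineK; last first.
    apply: (integrable_fin_num mOmega).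
    by apply: eq_integrable iu => // x _ /=; rewrite expr2.
  rewrite [RHS]integral_mkcond; apply: eq_integral => x _.
  rewrite !patchE poweR_EFin; case: ifPn => _ /=; last by rewrite normr0 powR0.
  by rewrite powR_mulrn// real_normK ?num_real// expr2.
by rewrite poweR_EFin powR12_sqrt// ip_ge0.
Qed.

Lemma L2_cvg_ip (u_ : nat -> E -> R) u : (forall m, sqint mu Omega (u_ m)) -> sqint mu Omega u ->
  L2_cvg Omega u_ u ->
  innerO (fun x => u_ m x - u x) (fun x => u_ m x - u x) @[m --> \oo] --> 0.
Proof.
move=> su_ su cu; pose F m := innerO (fun x => u_ m x - u x) (fun x => u_ m x - u x).
have c : (Num.sqrt (F m))%:E @[m --> \oo] --> 0%E.
  by under eq_cvg do rewrite -(Lnorm2_ip (sqintB mOmega (su_ _) su)).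
have cF : Num.sqrt (F m) @[m --> \oo] --> (0 : R) by exact: ((fine_cvgP _ _).1 c).2.
have FE m : F m = Num.sqrt (F m) * Num.sqrt (F m).
  by rewrite -expr2 sqr_sqrtr// ip_ge0.
have h : Num.sqrt (F m) * Num.sqrt (F m) @[m --> \oo] --> (0 * 0 : R) by exact: cvgM.
rewrite mulr0 in h; have FE' : F = (fun m => Num.sqrt (F m) * Num.sqrt (F m)) by apply/funext.
by change (F m @[m --> \oo] --> (0 : R)); rewrite FE'.
Qed.

Variable L : R.
Hypothesis L0 : 0 < L.
Hypothesis OmegaL : Omega `<=` cube L.

Lemma Omega_finite : (mu Omega < +oo)%E.
Proof. exact: sub_cube_finite mOmega (ltW L0) OmegaL. Qed.

Lemma cosd_sqint xi : sqint mu Omega (cosd xi).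
Proof.
apply: (bounded_sqint mOmega (C := 1) Omega_finite) => [|x _]; last exact: cos_max.
by apply: measurable_funTS; apply: continuous_rV_measurable; exact: continuous_cosd.
Qed.

Lemma sind_sqint xi : sqint mu Omega (sind xi).
Proof.
apply: (bounded_sqint mOmega (C := 1) Omega_finite) => [|x _]; last exact: sin_max.
by apply: measurable_funTS; apply: continuous_rV_measurable; exact: continuous_sind.
Qed.

Lemma test_fun_off_support (phi : E -> R) x : ~ closure [set x | phi x != 0] x ->
  phi x = 0 /\ forall i, partial i phi x = 0.
Proof.
move=> nx; split; first by apply/eqP; apply: contraPT nx => px; apply; exact: subset_closure.
move=> i; rewrite /partial (@near_eq_derive _ _ _ phi (fun=> 0)) ?derive_cst//.
have : nbhs x (~` closure [set x | phi x != 0]).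
  by apply: open_nbhs_nbhs; split => //; apply: closed_openC; exact: closed_closure.
apply: filterS => y ny; apply/eqP; apply: contraPT ny => py; apply.
exact: subset_closure.
Qed.

Lemma test_fun_off (phi : E -> R) x : test_fun Omega phi -> ~ Omega x ->
  phi x = 0 /\ forall i, partial i phi x = 0.
Proof. by move=> [_ _ sO] nx; apply: test_fun_off_support => /sO. Qed.

Lemma test_fun_continuous phi : test_fun Omega phi -> continuous phi.
Proof. by move=> [/(_ 0)]. Qed.

Lemma test_fun_derivable phi i x : test_fun Omega phi -> derivable phi x (delta_mx ord0 i).
Proof. by move=> [/(_ 1)[_ /(_ i)[]]]. Qed.

Lemma test_fun_continuous_partial phi i : test_fun Omega phi -> continuous (partial i phi).
Proof. by move=> [/(_ 1)[_ /(_ i)[]]]. Qed.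

Lemma test_fun_bounded phi (f : E -> R) : test_fun Omega phi -> continuous f ->
  exists C, forall x, closure [set x | phi x != 0] x -> `|f x| <= C.
Proof.
move=> [_ K _] cf.
have /compact_bounded[M [_ hM]] : compact (f @` closure [set x | phi x != 0]).
  by apply: continuous_compact => //; exact: continuous_subspaceT.
exists (`|M| + 1) => x Kx; apply: (hM (`|M| + 1)); last by exists x.
by rewrite (le_lt_trans (ler_norm _))// ltrDl.
Qed.

Lemma test_fun_bounds phi : test_fun Omega phi ->
  exists C, (forall x, `|phi x| <= C) /\ forall i x, `|partial i phi x| <= C.
Proof.
move=> tphi.
have [C0 C0P] := test_fun_bounded tphi (test_fun_continuous tphi).
have /choice[C1 C1P] := fun i => test_fun_bounded tphi (@test_fun_continuous_partial _ i tphi).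
pose C := `|C0| + \sum_i `|C1 i|.
have C00 : 0 <= C by rewrite addr_ge0// sumr_ge0.
exists C; split => [x|i x].
  have [Kx|/test_fun_off_support[-> _]] := pselect (closure [set x | phi x != 0] x); last by rewrite normr0.
  by rewrite (le_trans (C0P _ Kx))// (le_trans (ler_norm _))// lerDl sumr_ge0.
have [Kx|/test_fun_off_support[_ ->]] := pselect (closure [set x | phi x != 0] x); last by rewrite normr0.
rewrite (le_trans (C1P _ _ Kx))// (le_trans (ler_norm _))// /C (bigD1 i)//=.
by rewrite addrCA lerDl addr_ge0// sumr_ge0.
Qed.

Lemma test_fun_sqint phi : test_fun Omega phi -> sqint mu Omega phi.
Proof.
move=> tphi; have [C [hC _]] := test_fun_bounds tphi.
apply: (bounded_sqint mOmega (C := C) Omega_finite) => [|x _]; last exact: hC.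
by apply: measurable_funTS; apply: continuous_rV_measurable; exact: test_fun_continuous.
Qed.

Lemma test_fun_partial_sqint phi i : test_fun Omega phi -> sqint mu Omega (partial i phi).
Proof.
move=> tphi; have [C [_ hC]] := test_fun_bounds tphi.
apply: (bounded_sqint mOmega (C := C) Omega_finite) => [|x _]; last exact: hC.
by apply: measurable_funTS; apply: continuous_rV_measurable; exact: test_fun_continuous_partial.
Qed.

Let D : nat := (Num.truncn L).+2.

Let LD : L < D%:R - 1.
Proof. by rewrite /D -natr1 addrK truncnS_gt. Qed.

Let Omega_box : Omega `<=` @box R n D.
Proof.
move=> x /OmegaL/cubeP xL i; have := xL i; rewrite /= in_itv /= ler_norml => /andP[h1 h2].
by move: LD; set d := D%:R; move=> Ld; apply/andP; split; lra.
Qed.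

Let Rintegral_box (f : E -> R) : (forall x, ~ Omega x -> f x = 0) ->
  \int[mu]_(x in @box R n D) f x = \int[mu]_(x in Omega) f x.
Proof.
move=> f0; rewrite Rintegral_mkcond [RHS]Rintegral_mkcond; apply: eq_Rintegral => x _.
rewrite !patchE; case: ifPn => xQ; case: ifPn => // xO.
  by rewrite f0//; move: xO; rewrite notin_setE.
by move: xQ; rewrite notin_setE => /(_ (Omega_box (set_mem xO))).
Qed.

Let power_spectrum_box phi xi : test_fun Omega phi ->
  power_spectrum (@box R n D) phi xi = power_spectrum Omega phi xi.
Proof.
move=> tphi; rewrite /power_spectrum /ip !Rintegral_box// => x nx;
by rewrite (test_fun_off tphi nx).1 mul0r.
Qed.

Lemma measurable_power_spectrum_test phi : test_fun Omega phi ->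
  measurable_fun setT (power_spectrum Omega phi).
Proof.
move=> tphi; have [C [hC hC']] := test_fun_bounds tphi.
rewrite (_ : power_spectrum Omega phi = power_spectrum (@box R n D) phi); last first.
  by apply/funext => xi; rewrite power_spectrum_box.
apply: (@measurable_power_spectrum_box R n D phi C); [exact: test_fun_continuous|exact: hC].
Qed.

Variables kappa z rho : R.
Hypothesis kappa0 : 0 < kappa.
Hypothesis kappaP : forall t : R, `|t| <= pi / 2 -> kappa * `|t| <= `|sin t|.
Hypothesis z0 : 0 <= z.
Hypothesis rho0 : 0 < rho.
Hypothesis zrho : z <= kappa ^+ 2 * rho ^+ 2.
Local Notation B := [set xi : E | sqnorm xi < rho ^+ 2].

(** [energy_inequality] in a box large enough that the function vanishes near
    its boundary; off [Omega] all integrands vanish. *)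
Lemma test_fun_energy phi : test_fun Omega phi ->
  (2 * pi) ^+ n * (z * innerO phi phi - \sum_i innerO (partial i phi) (partial i phi)) <=
  \int[mu]_(xi in B) ((z - sqnorm xi) * power_spectrum Omega phi xi).
Proof.
move=> tphi; have [C [hC hC']] := test_fun_bounds tphi.
have supp (x : E) i : D%:R - 1 <= `|x ord0 i| -> phi x = 0.
  move=> h; apply: (proj1 (test_fun_off tphi _)) => /OmegaL/cubeP/(_ i) xL.
  by have := lt_le_trans LD (le_trans h xL); rewrite ltxx.
have := energy_inequality supp (test_fun_continuous tphi)
  (fun i x => @test_fun_derivable phi i x tphi) (fun i => @test_fun_continuous_partial phi i tphi)
  hC hC' kappa0 kappaP z0 rho0 zrho.
have -> : \int[mu]_(xi in B) ((z - sqnorm xi) * power_spectrum (@box R n D) phi xi) =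
    \int[mu]_(xi in B) ((z - sqnorm xi) * power_spectrum Omega phi xi).
  by apply: eq_Rintegral => xi _; rewrite power_spectrum_box.
apply: le_trans; rewrite le_eqVlt; apply/orP; left; apply/eqP; congr (_ * (_ * _ - _)).
  rewrite Rintegral_box => [|x nx]; last by rewrite (test_fun_off tphi nx).1 expr0n.
  by apply: eq_Rintegral => x _; rewrite expr2.
apply: eq_bigr => i _.
rewrite Rintegral_box => [|x nx]; last by rewrite (test_fun_off tphi nx).2 expr0n.
by apply: eq_Rintegral => x _; rewrite expr2.
Qed.

Let mB : measurable B. Proof. exact: measurable_sqnorm_lt. Qed.
Let Boo : (mu B < +oo)%E.
Proof. by apply: (sub_cube_finite mB _ (@sqnorm_lt_cube R n rho)). Qed.

Lemma power_spectrum_le u xi : sqint mu Omega u ->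
  0 <= power_spectrum Omega u xi <= 2 * (innerO u u * fine (mu Omega)).
Proof.
move=> su; rewrite addr_ge0 ?sqr_ge0//= mulr_natl mulr2n.
have le1 (f : E -> R) : sqint mu Omega f -> (forall x, f x ^+ 2 <= 1) ->
    innerO u f ^+ 2 <= innerO u u * fine (mu Omega).
  move=> sf f1; apply: (le_trans (ip_cauchy_schwarz mOmega su sf)).
  apply: ler_wpM2l; first exact: ip_ge0.
  rewrite -[leRHS]mul1r -(Rintegral_cst _ mOmega).
  apply: le_Rintegral => //; first exact: sqint_mul.
    apply: (bounded_fun_integrable mOmega Omega_finite (f := fun=> 1) (C := 1)) => // x _.
    by rewrite normr1.
  by move=> x _; rewrite -expr2.
apply: lerD.
  apply: (le1 _ (cosd_sqint xi)) => x.
  by rewrite -real_normK ?num_real// exprn_ile1// cos_max.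
apply: (le1 _ (sind_sqint xi)) => x.
by rewrite -real_normK ?num_real// exprn_ile1// sin_max.
Qed.

Lemma sobolev_approx u g : sobolev_H10 Omega u g ->
  exists phi_ : nat -> E -> R,
  [/\ forall m, test_fun Omega (phi_ m),
     forall f, sqint mu Omega f -> innerO (phi_ m) f @[m --> \oo] --> innerO u f,
     innerO (phi_ m) (phi_ m) @[m --> \oo] --> innerO u u &
     forall i, innerO (partial i (phi_ m)) (partial i (phi_ m)) @[m --> \oo] --> innerO (g i) (g i)].
Proof.
move=> [[/L2_sqint su L2g _] [phi_ [tphi cu cg]]].
have sg i := L2_sqint (L2g i).
have sphi m := test_fun_sqint (tphi m).
have spphi i m := test_fun_partial_sqint i (tphi m).
exists phi_; split => //.
- move=> f sf; apply: (ip_cvg (v_ := fun=> f) mOmega) => //; first exact: L2_cvg_ip.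
  rewrite (_ : ip _ _ _ _ = 0); first exact: cvg_cst.
  by rewrite (ipBB mOmega sf sf); ring.
- by apply: (ip_cvg mOmega) => //; exact: L2_cvg_ip.
- move=> i; apply: (ip_cvg (u_ := fun m => partial i (phi_ m)) (v_ := fun m => partial i (phi_ m)) mOmega) => //;
  exact: (L2_cvg_ip (u_ := fun m => partial i (phi_ m))).
Qed.

Lemma power_spectrum_approx u (phi_ : nat -> E -> R) :
  (forall f, sqint mu Omega f -> innerO (phi_ m) f @[m --> \oo] --> innerO u f) ->
  forall xi, power_spectrum Omega (phi_ m) xi @[m --> \oo] --> power_spectrum Omega u xi.
Proof.
move=> cphi xi; rewrite /power_spectrum !expr2; under eq_cvg do rewrite !expr2.
have c1 := cphi _ (cosd_sqint xi); have c2 := cphi _ (sind_sqint xi).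
by apply: cvgD; apply: cvgM.
Qed.

Lemma measurable_power_spectrum u g : sobolev_H10 Omega u g ->
  measurable_fun setT (power_spectrum Omega u).
Proof.
move=> /sobolev_approx[phi_ [tphi /power_spectrum_approx cphi _ _]].
apply: (measurable_realfun.measurable_fun_cvg (h := fun m => power_spectrum Omega (phi_ m))) => //.
by move=> m; exact: measurable_power_spectrum_test.
Qed.

(** Only integrals over a fixed ball of frequencies occur, so the inequality
    passes from test functions to their limits in [H^1_0]: there the power
    spectra converge pointwise and stay bounded. *)
Lemma sobolev_energy u g : sobolev_H10 Omega u g ->
  (2 * pi) ^+ n * (z * innerO u u - \sum_i innerO (g i) (g i)) <=
  \int[mu]_(xi in B) ((z - sqnorm xi) * power_spectrum Omega u xi).
Proof.
move=> /sobolev_approx[phi_ [tphi cphi cpp cdd]].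
have lhs : (2 * pi) ^+ n * (z * innerO (phi_ m) (phi_ m) -
      \sum_i innerO (partial i (phi_ m)) (partial i (phi_ m))) @[m --> \oo] -->
    (2 * pi) ^+ n * (z * innerO u u - \sum_i innerO (g i) (g i)).
  apply: cvgM; first exact: cvg_cst.
  apply: cvgB; first by apply: cvgM => //; exact: cvg_cst.
  by apply: (cvg_sumR (F := \oo)) => i; exact: cdd.
have [M MP] : exists M, forall m, innerO (phi_ m) (phi_ m) <= M.
  have /cvg_seq_bounded[M [_ hM]] : cvgn (fun m => innerO (phi_ m) (phi_ m)).
    by apply/cvg_ex; eexists; exact: cpp.
  exists (`|M| + 1) => m; rewrite (le_trans (ler_norm _))//; apply: hM => //.
  by rewrite (le_lt_trans (ler_norm _))// ltrDl.
have rhs : \int[mu]_(xi in B) ((z - sqnorm xi) * power_spectrum Omega (phi_ m) xi) @[m --> \oo] -->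
    \int[mu]_(xi in B) ((z - sqnorm xi) * power_spectrum Omega u xi).
  apply: (bounded_cvg_Rintegral mB Boo (C := (z + rho ^+ 2) * (2 * (M * fine (mu Omega))))).
  - move=> m; apply: measurable_funTS; apply: measurable_funM; last exact: measurable_power_spectrum_test.
    by apply: measurable_funB => //; exact: measurable_sqnorm.
  - move=> m x Bx; rewrite normrM; apply: ler_pM => //.
      have Bx' : sqnorm x < rho ^+ 2 by []; have s0 := sqnorm_ge0 x.
      by rewrite ler_norml; apply/andP; split; move: Bx' s0 z0; set a := sqnorm x; set b := rho ^+ 2; lra.
    have /andP[p0 p1] := power_spectrum_le x (test_fun_sqint (tphi m)).
    rewrite ger0_norm// (le_trans p1)// ler_pM2l//; apply: ler_wpM2r => //.
    by rewrite fine_ge0.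
  - by move=> x _; apply: cvgM; [exact: cvg_cst|exact: power_spectrum_approx].
by apply: (ler_cvg_to lhs rhs); apply: nearW => m; exact: test_fun_energy.
Qed.

End sobolev.

(** * Orthonormalization *)

Section gram_schmidt.
Context d (T : measurableType d) (R : realType).
Variables (mu : {measure set T -> \bar R}) (D : set T).
Hypothesis mD : measurable D.
Variable V : set (T -> R).
Hypothesis V_axpy : forall u v c, V u -> V v -> V (fun x => u x + c * v x).
Hypothesis V_sqint : forall u, V u -> sqint mu D u.

Lemma axpy_sum m (u : T -> R) (f : nat -> T -> R) (b : nat -> R) : V u ->
  (forall j, (j < m)%N -> V (f j)) -> V (fun x => u x + \sum_(j < m) b j * f j x).
Proof.
move=> Vu; elim: m => [_|m IH Vf].
  by rewrite (_ : (fun x => _) = u)//; apply/funext => x; rewrite big_ord0 addr0.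
rewrite (_ : (fun x => _) = (fun x => (u x + \sum_(j < m) b j * f j x) + b m * f m x)).
  by apply: V_axpy; [apply: IH => j jm; apply: Vf; exact: ltnW|exact: Vf].
by apply/funext => x; rewrite big_ord_recr /= addrA.
Qed.

(** The coefficients [C] are part of the statement because the induction uses
    them: if the next vector minus its projection had norm 0, it would be a null
    combination of the [e j] with last coefficient 1. *)
Lemma gram_schmidt m (e : nat -> T -> R) : (forall j, (j < m)%N -> V (e j)) ->
  (forall c : nat -> R, let w := fun x => \sum_(j < m) c j * e j x in
     ip mu D w w = 0 -> forall j, (j < m)%N -> c j = 0) ->
  exists f : nat -> T -> R, exists C : nat -> nat -> R,
    [/\ forall j, (j < m)%N -> V (f j),
        forall j, (j < m)%N -> f j = (fun x => \sum_(i < m) C j i * e i x) &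
        forall i j, (i < m)%N -> (j < m)%N -> ip mu D (f i) (f j) = (i == j)%:R].
Proof.
elim: m => [|m IH] Ve ind.
  by exists (fun _ _ => 0), (fun _ _ => 0); split.
have [|c /= c0 j jm|f [C [Vf fE fO]]] := IH.
- by move=> j jm; apply: Ve; exact: ltnW.
- pose c' k := if (k < m)%N then c k else 0.
  have := ind c'; rewrite /= (_ : (fun x => _) = (fun x => \sum_(j < m) c j * e j x)).
    by move=> /(_ c0 j (ltnW jm)); rewrite /c' jm.
  apply/funext => x; rewrite big_ord_recr /= /c' ltnn mul0r addr0.
  by apply: eq_bigr => i _; rewrite ltn_ord.
have sf j : (j < m)%N -> sqint mu D (f j) by move=> /Vf/V_sqint.
have Vem : V (e m) by exact: Ve.
have sem := V_sqint Vem.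
pose a j := ip mu D (e m) (f j).
pose w x := e m x + \sum_(j < m) (- a j) * f j x.
have Vw : V w by exact: (axpy_sum (fun j => - a j) Vem Vf).
have sw := V_sqint Vw.
have saf (i : 'I_m) : sqint mu D (fun x => - a i * f i x).
  by apply: (sqintZ mD); exact: sf.
have sS : sqint mu D (fun x => \sum_(i < m) - a i * f i x) by exact: (sqint_sum mD _ saf).
have wf j : (j < m)%N -> ip mu D w (f j) = 0.
  move=> jm; have sfj := sf _ jm.
  rewrite (ipDl mD sem sS sfj) (ip_suml mD _ saf sfj).
  rewrite (bigD1 (Ordinal jm))//= big1 ?addr0.
    by rewrite (ipZl mD _ sfj sfj) fO// eqxx mulr1 subrr.
  move=> i ij; rewrite (ipZl mD _ (sf _ (ltn_ord i)) sfj).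
  by rewrite fO// (_ : (i == j :> nat) = false) ?mulr0//; apply/negbTE.
pose dc k := if (k == m)%N then 1 else - \sum_(j < m) a j * C j k.
have wE : w = (fun x => \sum_(i < m.+1) dc i * e i x).
  apply/funext => x; rewrite big_ord_recr /= /dc eqxx mul1r addrC /w; congr (_ + _).
  transitivity (\sum_(j < m) \sum_(i < m) (- a j * C j i) * e i x).
    apply: eq_bigr => j _; rewrite fE// mulr_sumr; apply: eq_bigr => i _.
    by rewrite mulrA.
  rewrite exchange_big /=; apply: eq_bigr => i _.
  rewrite (_ : (i == m :> nat) = false); last by apply/negbTE; rewrite neq_ltn ltn_ord.
  by rewrite -mulr_suml -sumrN; congr (_ * _); apply: eq_bigr => j _; rewrite mulNr.
have w0 : ip mu D w w != 0.
  apply/eqP => w0; have := ind dc; rewrite /= -wE => /(_ w0 m (ltnSn m)) /eqP.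
  by rewrite /dc eqxx oner_eq0.
have wpos : 0 < ip mu D w w by rewrite lt_neqAle eq_sym w0 ip_ge0.
pose r := (Num.sqrt (ip mu D w w))^-1.
pose fm x := r * w x.
have Vfm : V fm.
  rewrite (_ : fm = (fun x => w x + (r - 1) * w x)); first exact: (V_axpy (r - 1) Vw Vw).
  by apply/funext => x; rewrite /fm; ring.
have fmfm : ip mu D fm fm = 1.
  rewrite (ipZl mD _ sw (V_sqint Vfm)) ipC (ipZl mD _ sw sw) mulrA -expr2 exprVn sqr_sqrtr ?ltW// mulVf//.
exists (fun k => if (k == m)%N then fm else f k).
exists (fun k i => if (k == m)%N then r * dc i else if (i == m)%N then 0 else C k i).
split.
- move=> j; rewrite ltnS leq_eqVlt => /predU1P[->|jm]; first by rewrite eqxx.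
  by rewrite (_ : (j == m) = false) ?ltn_eqF//; exact: Vf.
- move=> j; rewrite ltnS leq_eqVlt => /predU1P[->|jm].
    rewrite eqxx; apply/funext => x; rewrite /fm wE mulr_sumr.
    by apply: eq_bigr => i _; rewrite mulrA.
  rewrite (ltn_eqF jm) fE//; apply/funext => x.
  rewrite big_ord_recr /= eqxx mul0r addr0; apply: eq_bigr => i _.
  by rewrite (ltn_eqF (ltn_ord i)).
have fmf j : (j < m)%N -> ip mu D fm (f j) = 0.
  by move=> jm; rewrite (ipZl mD _ sw (sf _ jm)) wf// mulr0.
move=> i j; rewrite ltnS leq_eqVlt => /predU1P[->|im]; rewrite ltnS leq_eqVlt => /predU1P[->|jm].
- by rewrite !eqxx.
- by rewrite eqxx (ltn_eqF jm) fmf// gtn_eqF.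
- by rewrite eqxx (ltn_eqF im) ipC fmf.
- by rewrite (ltn_eqF im) (ltn_eqF jm) fO.
Qed.

Lemma ip_eq0_ae u : sqint mu D u -> ip mu D u u = 0 -> {ae mu, forall x, D x -> u x = 0}.
Proof.
move=> su u0; have [mu_ iu] := su.
have : (\int[mu]_(x in D) `|(u x ^+ 2)%:E| = 0)%E.
  transitivity (\int[mu]_(x in D) (u x ^+ 2)%:E)%E.
    by apply: eq_integral => x _; rewrite gee0_abs// lee_fin sqr_ge0.
  rewrite -(fineK (integrable_fin_num mD iu)).
  by transitivity ((ip mu D u u)%:E)%E; [|rewrite u0].
move/(ae_eq_integral_abs mu mD (measurable_int mu iu)).
apply: filterS => x /= h Dx; have := h Dx => -[] /eqP.
by rewrite sqrf_eq0 => /eqP.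
Qed.

End gram_schmidt.

(** * Orthonormal eigenfunctions *)

Section sobolev_linear.
Context (R : realType) (n : nat).
Local Notation E := 'rV[R]_n.
Local Notation mu := (@lebesgue_rV R n).
Implicit Types (u v phi psi : E -> R) (c : R).

Lemma partial_axpy i phi psi c : (forall x, derivable phi x (delta_mx ord0 i)) ->
  (forall x, derivable psi x (delta_mx ord0 i)) ->
  partial i (fun x => phi x + c * psi x) = (fun x => partial i phi x + c * partial i psi x).
Proof.
move=> d1 d2; apply/funext => x.
rewrite /partial (@deriveD _ _ _ phi (c *: psi))//; last exact: derivableZ.
by rewrite deriveZ.
Qed.

Lemma Ck_axpy k phi psi c : Ck k phi -> Ck k psi -> Ck k (fun x => phi x + c * psi x).
Proof.
elim: k phi psi => [|k IH] phi psi /=.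
  by move=> cphi cpsi x; exact: (cvgD (cphi x) (cvgM (cvg_cst c) (cpsi x))).
move=> [cphi dphi] [cpsi dpsi]; split.
  by move=> x; exact: (cvgD (cphi x) (cvgM (cvg_cst c) (cpsi x))).
move=> i; have [d1 k1] := dphi i; have [d2 k2] := dpsi i; split.
  by move=> x; apply: (@derivableD _ _ _ phi (c *: psi)) => //; exact: derivableZ.
by rewrite partial_axpy//; exact: IH.
Qed.

Variable Omega : set E.

Lemma test_fun_axpy phi psi c : test_fun Omega phi -> test_fun Omega psi ->
  test_fun Omega (fun x => phi x + c * psi x).
Proof.
move=> [Cphi Kphi sphi] [Cpsi Kpsi spsi].
have sub : closure [set x | phi x + c * psi x != 0] `<=`
    closure [set x | phi x != 0] `|` closure [set x | psi x != 0].
  rewrite -closureU; apply: closure_subset => x /=.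
  have [->|] := eqVneq (phi x) 0; last by left.
  have [->|] := eqVneq (psi x) 0; last by right.
  by rewrite mulr0 addr0 eqxx.
split; first by move=> k; exact: Ck_axpy.
  apply: subclosed_compact sub; first exact: closed_closure.
  exact: compactU.
by move=> x /sub[/sphi|/spsi].
Qed.

Hypothesis oOmega : open Omega.
Let mOmega : measurable Omega. Proof. exact: rV_open_measurable. Qed.
Variable L : R.
Hypothesis L0 : 0 < L.
Hypothesis OmegaL : Omega `<=` cube L.
Local Notation innerO := (ip mu Omega).

Lemma sqint_L2 u : sqint mu Omega u -> L2 Omega u.
Proof.
move=> su; have [mu_ _] := su; rewrite /L2 inE; apply/andP; split; rewrite inE /=.
  exact: ((measurable_restrictT _ mOmega).1 mu_).
by rewrite /finite_norm Lnorm2_ip// ltry.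
Qed.

Lemma ip_L2_cvg (u_ : nat -> E -> R) u : (forall m, sqint mu Omega (u_ m)) -> sqint mu Omega u ->
  innerO (fun x => u_ m x - u x) (fun x => u_ m x - u x) @[m --> \oo] --> 0 ->
  L2_cvg Omega u_ u.
Proof.
move=> su_ su h; rewrite /L2_cvg.
under eq_cvg do rewrite (Lnorm2_ip mOmega (sqintB mOmega (su_ _) su)).
apply: cvg_EFin; first exact: nearW.
have -> : (0 : R) = Num.sqrt 0 by rewrite sqrtr0.
exact: (continuous_cvg _ (@sqrt_continuous R _) h).
Qed.

Lemma L2_cvg_axpy (u_ v_ : nat -> E -> R) u v c : (forall m, sqint mu Omega (u_ m)) ->
  (forall m, sqint mu Omega (v_ m)) -> sqint mu Omega u -> sqint mu Omega v ->
  L2_cvg Omega u_ u -> L2_cvg Omega v_ v ->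
  L2_cvg Omega (fun m x => u_ m x + c * v_ m x) (fun x => u x + c * v x).
Proof.
move=> su_ sv_ su sv /(L2_cvg_ip mOmega su_ su) cu /(L2_cvg_ip mOmega sv_ sv) cv.
have sb m : sqint mu Omega (fun x => u_ m x - u x) by exact: (sqintB mOmega (su_ m) su).
have sd m : sqint mu Omega (fun x => v_ m x - v x) by exact: (sqintB mOmega (sv_ m) sv).
have s0 : sqint mu Omega (fun=> 0) by exact: sqint0.
apply: ip_L2_cvg.
- by move=> m; apply: (sqintD mOmega) => //; exact: sqintZ.
- by apply: (sqintD mOmega) => //; exact: sqintZ.
set F := fun m => _.
have cuv : innerO (fun x => u_ m x - u x) (fun x => v_ m x - v x) @[m --> \oo] --> 0.
  have -> : (0 : R) = innerO (fun=> 0) (fun=> 0).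
    by rewrite /ip; under eq_Rintegral do rewrite mulr0; rewrite Rintegral_cst// mul0r.
  apply: (ip_cvg (u_ := fun m x => u_ m x - u x) (v_ := fun m x => v_ m x - v x) mOmega sb sd s0 s0).
    by under eq_fun do under eq_fun do rewrite subr0.
  by under eq_fun do under eq_fun do rewrite subr0.
have FE m : F m = innerO (fun x => u_ m x - u x) (fun x => u_ m x - u x) +
    2 * c * innerO (fun x => u_ m x - u x) (fun x => v_ m x - v x) +
    c ^+ 2 * innerO (fun x => v_ m x - v x) (fun x => v_ m x - v x).
  rewrite /F.
  have -> : (fun x => u_ m x + c * v_ m x - (u x + c * v x)) =
      (fun x => (u_ m x - u x) + c * (v_ m x - v x)) by apply/funext => x; ring.
  have sc : sqint mu Omega (fun x => c * (v_ m x - v x)) by exact: (sqintZ mOmega c (sd m)).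
  have sall := sqintD mOmega (sb m) sc.
  rewrite (ipDl mOmega (sb m) sc sall) (ipZl mOmega c (sd m) sall).
  rewrite !(ipC _ _ _ (fun x => _ + c * _)).
  rewrite (ipDl mOmega (sb m) sc (sb m)) (ipDl mOmega (sb m) sc (sd m)).
  rewrite !(ipZl mOmega c (sd m)) //.
  rewrite (ipC _ _ (fun x => v_ m x - v x) (fun x => u_ m x - u x)); ring.
have -> : F = (fun m => innerO (fun x => u_ m x - u x) (fun x => u_ m x - u x) +
    2 * c * innerO (fun x => u_ m x - u x) (fun x => v_ m x - v x) +
    c ^+ 2 * innerO (fun x => v_ m x - v x) (fun x => v_ m x - v x)) by apply/funext.
rewrite (_ : (0 : R) = 0 + 2 * c * 0 + c ^+ 2 * 0); last by ring.
by apply: cvgD; [apply: cvgD => //|]; apply: cvgM => //; exact: cvg_cst.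
Qed.

Lemma sobolev_H10_axpy u g v h c : sobolev_H10 Omega u g -> sobolev_H10 Omega v h ->
  sobolev_H10 Omega (fun x => u x + c * v x) (fun i x => g i x + c * h i x).
Proof.
move=> [[L2u L2g wu] [p_ [tp cp cdp]]] [[L2v L2h wv] [q_ [tq cq cdq]]].
have su := L2_sqint mOmega L2u; have sv := L2_sqint mOmega L2v.
have sg i := L2_sqint mOmega (L2g i); have sh i := L2_sqint mOmega (L2h i).
have tsq phi : test_fun Omega phi -> sqint mu Omega phi by exact: (test_fun_sqint mOmega L0 OmegaL).
have tdsq phi i : test_fun Omega phi -> sqint mu Omega (partial i phi).
  exact: (test_fun_partial_sqint mOmega L0 OmegaL).
split; first split.
- by apply: sqint_L2; apply: (sqintD mOmega) => //; exact: sqintZ.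
- by move=> i; apply: sqint_L2; apply: (sqintD mOmega) => //; exact: sqintZ.
- move=> phi i tphi; have sphi := tsq _ tphi; have sdphi := tdsq _ i tphi.
  rewrite !innerE (ipDl mOmega su (sqintZ mOmega c sv) sdphi) (ipZl mOmega c sv sdphi).
  rewrite (ipDl mOmega (sg i) (sqintZ mOmega c (sh i)) sphi) (ipZl mOmega c (sh i) sphi).
  have := wu phi i tphi; have := wv phi i tphi; rewrite !innerE => -> ->; ring.
exists (fun m x => p_ m x + c * q_ m x); split.
- by move=> m; exact: test_fun_axpy.
- by apply: L2_cvg_axpy => // m; exact: tsq.
move=> i; rewrite (_ : (fun m => _) = (fun m x => partial i (p_ m) x + c * partial i (q_ m) x)).
  by apply: L2_cvg_axpy => // m; exact: tdsq.
by apply/funext => m; apply: partial_axpy => x; exact: test_fun_derivable.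
Qed.

(** The weak form of the eigenvalue equation, with the gradient of the
    eigenfunction kept as data. *)
Definition eigenpair (t : R) u (g : 'I_n -> E -> R) : Prop :=
  sobolev_H10 Omega u g /\
  forall v h, sobolev_H10 Omega v h -> \sum_i innerO (g i) (h i) = t * innerO u v.

Lemma H10_sqint u g : sobolev_H10 Omega u g -> sqint mu Omega u.
Proof. by move=> [[/(L2_sqint mOmega)]]. Qed.

Lemma H10_grad_sqint u g i : sobolev_H10 Omega u g -> sqint mu Omega (g i).
Proof. by move=> [[_ /(_ i)/(L2_sqint mOmega)]]. Qed.

Lemma eigenspaceP t u : Defs.eigenspace Omega t u -> exists g, eigenpair t u g.
Proof.
move=> [_ [g hu var]]; exists g; split => // v h hv.
have := var _ _ hv; rewrite innerE => ->.
exact: (ipZl mOmega t (H10_sqint hu) (H10_sqint hv)).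
Qed.

Lemma eigenpair_axpy t u g v h c : eigenpair t u g -> eigenpair t v h ->
  eigenpair t (fun x => u x + c * v x) (fun i x => g i x + c * h i x).
Proof.
move=> [hu vu] [hv vv]; split; first exact: sobolev_H10_axpy.
move=> w k hw; have sw := H10_sqint hw; have su := H10_sqint hu; have sv := H10_sqint hv.
rewrite (ipDl mOmega su (sqintZ mOmega c sv) sw) (ipZl mOmega c sv sw).
have -> : \sum_i innerO (fun x => g i x + c * h i x) (k i) =
    \sum_i innerO (g i) (k i) + c * \sum_i innerO (h i) (k i).
  rewrite mulr_sumr -big_split; apply: eq_bigr => i _ /=.
  have sg := H10_grad_sqint i hu; have sh := H10_grad_sqint i hv; have sk := H10_grad_sqint i hw.
  by rewrite (ipDl mOmega sg (sqintZ mOmega c sh) sk) (ipZl mOmega c sh sk).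
by rewrite (vu _ _ hw) (vv _ _ hw); ring.
Qed.

(** Each function tests the equation of the other, so that
    [s * (u, v) = t * (v, u)]. *)
Lemma eigenpair_orthogonal s t u g v h : s != t -> eigenpair s u g -> eigenpair t v h ->
  innerO u v = 0.
Proof.
move=> st [hu vu] [hv vv].
have := vu _ _ hv; have := vv _ _ hu.
under eq_bigr do rewrite ipC.
move=> ->; rewrite (ipC _ _ v u) => /eqP; rewrite -subr_eq0 -mulrBl mulf_eq0 subr_eq0.
by rewrite eq_sym (negPf st) => /eqP.
Qed.

Lemma orthonormal_eigenspace t m : has_dim Omega (Defs.eigenspace Omega t) m ->
  exists f : nat -> E -> R,
    (forall j, (j < m)%N -> exists g, eigenpair t (f j) g) /\
    (forall i j, (i < m)%N -> (j < m)%N -> innerO (f i) (f j) = (i == j)%:R).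
Proof.
move=> [e [eV ind _]].
pose V : set (E -> R) := [set u | exists g, eigenpair t u g].
have VZ u v c : V u -> V v -> V (fun x => u x + c * v x).
  by move=> [g hg] [h hh]; exists (fun i x => g i x + c * h i x); exact: eigenpair_axpy.
have Vs u : V u -> sqint mu Omega u by move=> [g [/H10_sqint]].
pose e' (k : nat) : E -> R := oapp e (fun=> 0) (insub k).
have e'E (j : 'I_m) : e' j = e j by rewrite /e' valK.
have e'V j : (j < m)%N -> V (e' j).
  by move=> jm; rewrite (e'E (Ordinal jm)); apply: eigenspaceP; exact: eV.
have e'ind (c : nat -> R) : let w := fun x => \sum_(j < m) c j * e' j x in
    innerO w w = 0 -> forall j, (j < m)%N -> c j = 0.
  move=> w w0 j jm.
  have sw : sqint mu Omega w.
    by apply: (sqint_sum mOmega) => k; apply: (sqintZ mOmega); apply: Vs; exact: e'V.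
  have aw := ip_eq0_ae mOmega sw w0.
  apply: (ind (fun k => c k) _ (Ordinal jm)).
  apply: filterS aw => x h Ox; rewrite -[RHS](h Ox) /w.
  by apply: eq_bigr => k _; rewrite e'E.
have [f [C [fV _ fO]]] := gram_schmidt mOmega VZ Vs e'V e'ind.
by exists f.
Qed.

(** Orthonormalize within each eigenspace; the indices at which [lambda] takes
    the value [t] are matched with the basis of that eigenspace by their
    position in the list that enumerates them. *)
Lemma orthonormal_eigenfunctions (lambda : nat -> R) : dirichlet_eigenvalues Omega lambda ->
  exists u : nat -> E -> R, exists g : nat -> 'I_n -> E -> R,
    (forall j, eigenpair (lambda j) (u j) (g j)) /\
    (forall i j, innerO (u i) (u j) = (i == j)%:R).
Proof.
move=> [_ hl].
have /choice[s sP] := hl.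
have /choice[f fP] : forall t, exists f : nat -> E -> R,
    (forall j, (j < size (s t))%N -> exists g, eigenpair t (f j) g) /\
    (forall i j, (i < size (s t))%N -> (j < size (s t))%N -> innerO (f i) (f j) = (i == j)%:R).
  by move=> t; have [_ _ /orthonormal_eigenspace] := sP t.
have js j : j \in s (lambda j) by have [_ -> _] := sP (lambda j).
pose u j := f (lambda j) (index j (s (lambda j))).
have /choice[g gP] : forall j, exists g, eigenpair (lambda j) (u j) g.
  by move=> j; apply: (fP (lambda j)).1; rewrite index_mem.
exists u, g; split => // i j.
have [lij|lij] := eqVneq (lambda i) (lambda j); last first.
  rewrite (eigenpair_orthogonal lij (gP i) (gP j)) (_ : (i == j) = false)//.
  by apply: contraNF lij => /eqP ->.
have is_ : i \in s (lambda j) by rewrite -lij.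
rewrite /u lij (fP (lambda j)).2 ?index_mem//; congr (nat_of_bool _)%:R.
apply/eqP/eqP => [ij|->//].
by rewrite -(nth_index 0 is_) ij nth_index.
Qed.

End sobolev_linear.

(** * The bathtub problem for slowly varying densities *)

Section bathtub.
Context (R : realType) (n : nat).
Local Notation E := 'rV[R]_n.
Local Notation mu := (@lebesgue_rV R n).
Local Notation B r := [set xi : E | sqnorm xi < r ^+ 2].
Local Notation omega := (@omega R n).
Local Notation vol A := (fine (mu A)).
Hypothesis n0 : (0 < n)%N.

Let mB r : measurable (B r). Proof. exact: measurable_sqnorm_lt. Qed.

Lemma ball_finite r : (mu (B r) < +oo)%E.
Proof. by apply: (sub_cube_finite (mB r) _ (@sqnorm_lt_cube R n r)). Qed.

Lemma vol_ball r : 0 <= r -> vol (B r) = r ^+ n * omega.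
Proof.
rewrite le_eqVlt => /predU1P[<-|r0]; last by rewrite lebesgue_rV_ball.
rewrite [in RHS]expr0n (gtn_eqF n0) mul0r (_ : [set _ | _] = set0) ?measure0//.
rewrite expr0n /=; apply/seteqP; split => // x /=.
by rewrite ltNge sqnorm_ge0.
Qed.

Lemma vol_setD (A A' : set E) : measurable A -> measurable A' -> A `<=` A' ->
  (mu A' < +oo)%E -> vol (A' `\` A) = vol A' - vol A.
Proof.
move=> mA mA' AA' Aoo.
have Afin : (mu A < +oo)%E by apply: le_lt_trans Aoo; apply: le_measure; rewrite ?inE.
by rewrite measureD// (setIidr AA') fineB// ge0_fin_numE.
Qed.

Lemma Rintegral_indic_sub (A A' : set E) (c : R) : measurable A -> measurable A' -> A `<=` A' ->
  (mu A' < +oo)%E -> \int[mu]_(x in A') (c * \1_A x) = c * vol A.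
Proof.
move=> mA mA' AA' Aoo.
have i1 : mu.-integrable A' (EFin \o (\1_A : E -> R)).
  apply: (bounded_fun_integrable mA' Aoo (C := 1)).
    by apply: measurable_funTS; exact: measurable_indic.
  by move=> x _; rewrite indicE; case: (_ \in _); rewrite ?normr1 ?normr0.
rewrite RintegralZl//; congr (_ * _).
by rewrite /Rintegral integral_indic// (setIidl AA').
Qed.

(** Between the radii [r i] and [r i.+1] the increments
    [r j.+1 ^+ 2 - r j ^+ 2] with [i <= j] add up to [r k ^+ 2 - r i ^+ 2],
    which dominates the integrand there. *)
Lemma Rintegral_ball_layers (r : nat -> R) k : (forall j, 0 <= r j) ->
  (forall j, r j <= r j.+1) ->
  \int[mu]_(x in B (r k)) (r k ^+ 2 - sqnorm x) <=
  \sum_(j < k) (r j.+1 ^+ 2 - r j ^+ 2) * (r j.+1 ^+ n * omega) + r 0 ^+ 2 * (r 0 ^+ n * omega).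
Proof.
move=> r0 rS.
have r2 j : r j ^+ 2 <= r j.+1 ^+ 2 by rewrite lerXn2r ?nnegrE.
have rk i : (i <= k)%N -> r i <= r k.
  elim: k => [|k IH]; first by rewrite leqn0 => /eqP ->.
  by rewrite leq_eqVlt => /predU1P[->//|/IH h]; exact: le_trans h (rS k).
have sub i : (i <= k)%N -> B (r i) `<=` B (r k).
  by move=> ik x /= xi; rewrite (lt_le_trans xi)// lerXn2r ?nnegrE// rk.
pose S x := \sum_(j < k) (r j.+1 ^+ 2 - r j ^+ 2) * \1_(B (r j.+1)) x + r 0 ^+ 2 * \1_(B (r 0)) x.
have bS i x : (r i ^+ 2 - sqnorm x) <=
    \sum_(j < i) (r j.+1 ^+ 2 - r j ^+ 2) * \1_(B (r j.+1)) x + r 0 ^+ 2 * \1_(B (r 0)) x.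
  have ind0 j y : 0 <= \1_(B (r j)) y :> R by rewrite indicE ler0n.
  have pos i' y : 0 <= \sum_(j < i') (r j.+1 ^+ 2 - r j ^+ 2) * \1_(B (r j.+1)) y +
      r 0 ^+ 2 * \1_(B (r 0)) y.
    rewrite addr_ge0 ?mulr_ge0 ?sqr_ge0//; apply: sumr_ge0 => j _.
    by rewrite mulr_ge0// subr_ge0.
  elim: i => [|i IH].
    have [xr|xr] := ltP (sqnorm x) (r 0 ^+ 2); last by rewrite (le_trans _ (pos _ _))// subr_le0.
    by rewrite big_ord0 add0r indicE mem_set// mulr1 lerBlDr lerDl sqnorm_ge0.
  have [xr|xr] := ltP (sqnorm x) (r i.+1 ^+ 2); last by rewrite (le_trans _ (pos _ _))// subr_le0.
  rewrite big_ord_recr /= indicE mem_set// mulr1 addrAC.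
  by move: IH; set s := \sum_(j < i) _; lra.
have iind j : (j <= k)%N -> forall c : R, mu.-integrable (B (r k)) (EFin \o (fun x => c * \1_(B (r j)) x)).
  move=> jk c; apply: (integrableZR (mB _)).
  apply: (bounded_fun_integrable (mB _) (ball_finite _) (C := 1)).
    by apply: measurable_funTS; exact: measurable_indic.
  by move=> x _; rewrite indicE; case: (_ \in _); rewrite ?normr1 ?normr0.
have isum : mu.-integrable (B (r k)) (EFin \o (fun x => \sum_(j < k) (r j.+1 ^+ 2 - r j ^+ 2) * \1_(B (r j.+1)) x)).
  by apply: (integrable_sumR (mB _)) => j; exact: iind.
apply: (@le_trans _ _ (\int[mu]_(x in B (r k)) S x)).
  apply: le_Rintegral => //.
  - apply: (bounded_fun_integrable (mB _) (ball_finite _) (C := r k ^+ 2)).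
      by apply: measurable_funTS; apply: measurable_funB => //; exact: measurable_sqnorm.
    move=> x /= xr; have := sqnorm_ge0 x; rewrite ger0_norm; lra.
  - by apply: (integrableDR (mB _)) => //; exact: iind.
rewrite RintegralD//; last exact: iind.
rewrite Rintegral_sum//; last by move=> j; exact: iind.
rewrite Rintegral_indic_sub//; [|exact: sub|exact: ball_finite].
rewrite vol_ball// lerD2r; apply: ler_sum => j _.
by rewrite Rintegral_indic_sub//; [rewrite vol_ball|exact: sub|exact: ball_finite].
Qed.

Lemma sqnorm_shell_vol (a b : R) : 0 <= a -> a <= b ->
  (b - a) * b ^+ n.-1 * omega <= vol (B b `\` B a).
Proof.
move=> a0 ab; have b0 := le_trans a0 ab.
rewrite vol_setD//; [|by move=> x /= xa; rewrite (lt_le_trans xa)// lerXn2r ?nnegrE|exact: ball_finite].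
rewrite !vol_ball// -mulrBl ler_pM2r ?omega_gt0// mulrBl.
have nE (t : R) : t ^+ n = t * t ^+ n.-1 by rewrite -exprS prednK.
rewrite !nE lerD2l lerN2; apply: ler_wpM2l => //.
by rewrite lerXn2r ?nnegrE.
Qed.

(** A density [F <= M] that cannot drop from nearly [M] to nearly 0 across a
    spherical layer of width comparable to [delta] misses the extremal value
    of the bathtub problem, attained by [M] times the indicator of a ball, by
    an amount of order [r ^+ n]: at every [x] just inside the sphere either
    [F x] is far from [M], or [F] is far from 0 at the dilated point just
    outside. *)
Lemma bathtub_gain (F : E -> R) (M r delta rho : R) :
  measurable_fun setT F -> 0 < M -> (forall x, 0 <= F x <= M) ->
  0 < delta -> 4 * delta <= r -> 4 * r <= rho ->
  (forall x, (r - 2 * delta) ^+ 2 <= sqnorm x < (r - delta) ^+ 2 ->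
     M / 4 <= M - F x + F (((r + delta) / (r - 2 * delta)) *: x)) ->
  \int[mu]_(x in B rho) ((r ^+ 2 - sqnorm x) * F x) + 
    r * delta * (M / 8) * (delta * (r / 2) ^+ n.-1 * omega) <=
  M * \int[mu]_(x in B r) (r ^+ 2 - sqnorm x).
Proof.
move=> mF M0 FM d0 dr rrho slow.
have r0 : 0 < r by lra.
have rho0 : 0 < rho by lra.
set s := (r + delta) / (r - 2 * delta).
have r2d : 0 < r - 2 * delta by lra.
have s1 : 1 <= s by rewrite ler_pdivlMr//; lra.
have s0 : 0 < s by lra.
pose A := B (r - delta) `\` B (r - 2 * delta).
have mA : measurable A by exact: measurableD.
have AP x : A x -> (r - 2 * delta) ^+ 2 <= sqnorm x < (r - delta) ^+ 2.
  by move=> [/= h1 /negP]; rewrite -leNgt => ->.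
pose G := [set x | M / 8 <= M - F x].
have mG : measurable G.
  rewrite (_ : G = F @^-1` `]-oo, M - M / 8]%classic).
    by rewrite -[X in measurable X]setTI; apply: mF => //; exact: measurable_itv.
  by apply/seteqP; split => x; rewrite /G /= in_itv /=; lra.
(* where [F] stays close to [M] inside, it is bounded below outside, on [A3] *)
pose A1 := A `&` G; pose A2 := A `\` G; pose A3 := [set x | A2 (s^-1 *: x)].
have mA1 : measurable A1 by exact: measurableI.
have mA2 : measurable A2 by exact: measurableD.
have mdil : measurable_fun setT (fun x : E => s^-1 *: x).
  apply: measurable_fun_coordP => i; rewrite (_ : (fun x => _) = (fun x : E => s^-1 * x ord0 i)).
    by apply: measurable_funM => //; exact: measurable_coord.
  by apply/funext => x; rewrite mxE.
have mA3 : measurable A3 by rewrite -[X in measurable X]setTI; exact: mdil.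
have A3P x : A3 x -> (r + delta) ^+ 2 <= sqnorm x < rho ^+ 2 /\ M / 8 <= F x.
  move=> [Ax nG]; have /andP[h1 h2] := AP _ Ax; have sl := slow _ (AP _ Ax).
  have xE : s *: (s^-1 *: x) = x by rewrite scalerA divff ?scale1r// gt_eqF.
  rewrite -/s xE in sl; split; last by move: nG => /= /negP; rewrite -ltNge; lra.
  have xs : sqnorm x = s ^+ 2 * sqnorm (s^-1 *: x) by rewrite -sqnormZ xE.
  have s20 : 0 < s ^+ 2 by rewrite exprn_gt0.
  have sE : s * (r - 2 * delta) = r + delta by rewrite /s divfK// gt_eqF.
  rewrite xs; apply/andP; split.
    by rewrite -sE exprMn ler_pM2l.
  apply: (@lt_le_trans _ _ (s ^+ 2 * (r - delta) ^+ 2)); first by rewrite ltr_pM2l.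
  rewrite -exprMn lerXn2r ?nnegrE//; [by rewrite mulr_ge0 ?ltW//; lra|exact: ltW|].
  nra.
have A1P x : A1 x -> sqnorm x < (r - delta) ^+ 2 /\ M / 8 <= M - F x.
  by move=> [/AP /andP[_ h] /= h'].
have rd2 : (r - delta) ^+ 2 <= r ^+ 2 - r * delta by nra.
have rd3 : r ^+ 2 + r * delta <= (r + delta) ^+ 2 by nra.
have disj : A1 `&` A3 = set0.
  apply/seteqP; split => // x [/A1P[h1 _] /A3P[/andP[h2 _] _]].
  by have := le_lt_trans h2 h1; rewrite ltNge; nra.
have subrho : B r `<=` B rho.
  by move=> x /= xr; rewrite (lt_le_trans xr)// lerXn2r ?nnegrE; lra.
have sub13 : A1 `|` A3 `<=` B rho.
  move=> x [/A1P[h _]|/A3P[/andP[_ h] _]] //=.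
  apply: subrho => /=; apply: (lt_le_trans h); apply: (le_trans rd2).
  by rewrite lerBlDr lerDl mulr_ge0// ltW.
have mA13 : measurable (A1 `|` A3) by exact: measurableU.
(* the two pieces together are at least as large as the inner shell *)
have volA : vol A <= vol (A1 `|` A3).
  have fin1 : (mu A1 < +oo)%E.
    apply: le_lt_trans (ball_finite rho); apply: le_measure; rewrite ?inE//.
    by move=> x h; apply: sub13; left.
  have fin3 : (mu A3 < +oo)%E.
    apply: le_lt_trans (ball_finite rho); apply: le_measure; rewrite ?inE//.
    by move=> x h; apply: sub13; right.
  have fin2 : (mu A2 < +oo)%E.
    apply: le_lt_trans (ball_finite (r - delta)); apply: le_measure; rewrite ?inE//.
    by move=> x [[]].
  have AE : A = A1 `|` A2 by rewrite /A1 /A2 setUIDK.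
  have d12 : A1 `&` A2 = set0.
    by apply/seteqP; split => // x [[_ g] [_ ng]].
  rewrite {1}AE !measureU// !fineD ?ge0_fin_numE// lerD2l.
  have si0 : 0 < s^-1 by rewrite invr_gt0.
  have A3E : vol A3 = s ^+ n * vol A2.
    rewrite /A3 (lebesgue_rV_dil si0 mA2) fineM ?ge0_fin_numE ?ltry// ?lee_fin ?invr_ge0 ?exprn_ge0 ?ltW//=.
    by rewrite exprVn invrK.
  change (vol A2 <= vol A3); rewrite A3E ler_peMl ?fine_ge0//.
  exact: exprn_ege1.
have shell : delta * (r / 2) ^+ n.-1 * omega <= vol A.
  have := @sqnorm_shell_vol (r - 2 * delta) (r - delta) (ltW r2d).
  rewrite -/A => h; apply: le_trans (h _); last by lra.
  rewrite ler_pM2r ?omega_gt0// (_ : r - delta - (r - 2 * delta) = delta); last by ring.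
  by rewrite ler_pM2l// lerXn2r ?nnegrE; lra.
pose c := r * delta * (M / 8).
have c0 : 0 <= c by rewrite /c !mulr_ge0// ltW.
have iF : mu.-integrable (B rho) (EFin \o (fun x => (r ^+ 2 - sqnorm x) * F x)).
  apply: (bounded_fun_integrable (mB _) (ball_finite _) (C := (r ^+ 2 + rho ^+ 2) * M)).
    apply: measurable_funTS; apply: measurable_funM => //.
    by apply: measurable_funB => //; exact: measurable_sqnorm.
  move=> x /= xr; rewrite normrM; have /andP[F0 F1] := FM x; have x0 := sqnorm_ge0 x.
  have rr := sqr_ge0 r; apply: ler_pM => //; last by rewrite ger0_norm.
  by rewrite ler_norml; apply/andP; split; lra.
have iind (X : set E) (k : R) : measurable X -> mu.-integrable (B rho) (EFin \o (fun x => k * \1_X x)).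
  move=> mX; apply: (integrableZR (mB _)).
  apply: (bounded_fun_integrable (mB _) (ball_finite _) (C := 1)).
    by apply: measurable_funTS; exact: measurable_indic.
  by move=> x _; rewrite indicE; case: (_ \in _); rewrite ?normr1 ?normr0.
have i0 : mu.-integrable (B rho) (EFin \o (fun x => (r ^+ 2 - sqnorm x) * \1_(B r) x)).
  apply: (bounded_fun_integrable (mB _) (ball_finite _) (C := r ^+ 2 + rho ^+ 2)).
    apply: measurable_funTS; apply: measurable_funM => //.
      by apply: measurable_funB => //; exact: measurable_sqnorm.
  move=> x /= xr; have x0 := sqnorm_ge0 x; have rr := sqr_ge0 r.
  rewrite normrM -[leRHS]mulr1; apply: ler_pM => //.
    by rewrite ler_norml; apply/andP; split; lra.
  by rewrite indicE; case: (_ \in _); rewrite ?normr1 ?normr0.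
have -> : \int[mu]_(x in B r) (r ^+ 2 - sqnorm x) =
    \int[mu]_(x in B rho) ((r ^+ 2 - sqnorm x) * \1_(B r) x).
  rewrite Rintegral_mkcond [RHS]Rintegral_mkcond; apply: eq_Rintegral => x _.
  rewrite !patchE indicE; case: ifPn => xr; case: ifPn => xrho; rewrite ?mulr1 ?mulr0//.
  by move: xrho; rewrite notin_setE => /(_ (subrho _ (set_mem xr))).
apply: (@le_trans _ _ (\int[mu]_(x in B rho) ((r ^+ 2 - sqnorm x) * F x) + c * vol (A1 `|` A3))).
  by rewrite lerD2l -/c; apply: ler_wpM2l => //; exact: le_trans shell volA.
rewrite -(Rintegral_indic_sub c mA13 (mB rho) sub13 (ball_finite _)).
rewrite -RintegralD//; last exact: iind.
rewrite -RintegralZl//; apply: le_Rintegral => //.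
- by apply: (integrableDR (mB _)) => //; exact: iind.
- exact: (integrableZR (mB _) M i0).
move=> x xrho; have /andP[F0 F1] := FM x.
rewrite [\1_(B r) x]indicE [\1_(_ `|` _) x]indicE.
have [xA1|nA1] := pselect (A1 x).
  have [h1 h2] := A1P x xA1; rewrite (mem_set (or_introl xA1 : (A1 `|` A3) x)) mulr1.
  have h3 : r * delta <= r ^+ 2 - sqnorm x by lra.
  rewrite mem_set ?mulr1; last by rewrite /=; nra.
  have M8 : 0 <= M / 8 by lra.
  have := ler_pM (mulr_ge0 (ltW r0) (ltW d0)) M8 h3 h2; rewrite -/c; lra.
have [xA3|nA3] := pselect (A3 x).
  have [/andP[h1 _] h2] := A3P x xA3; rewrite (mem_set (or_intror xA3 : (A1 `|` A3) x)) mulr1.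
  have h3 : r * delta <= sqnorm x - r ^+ 2 by lra.
  have rd : 0 <= r * delta by rewrite mulr_ge0// ltW.
  rewrite memNset ?mulr0; last by move=> /= h; lra.
  have M8 : 0 <= M / 8 by lra.
  have := ler_pM rd M8 h3 h2; rewrite -/c; lra.
rewrite (memNset (A := A1 `|` A3)); last by case.
rewrite mulr0 addr0; have [xr|xr] := ltP (sqnorm x) (r ^+ 2).
  by rewrite mem_set// mulr1 mulrC ler_wpM2r// subr_ge0 ltW.
rewrite memNset ?mulr0; last by move=> /= h; lra.
by rewrite mulr_le0_ge0// subr_le0.
Qed.

End bathtub.

(** * The density of an orthonormal family *)

Section spectral_density.
Context (R : realType) (n : nat).
Local Notation E := 'rV[R]_n.
Local Notation mu := (@lebesgue_rV R n).
Variable Omega : set E.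
Hypothesis mOmega : measurable Omega.
Variable L : R.
Hypothesis L0 : 0 < L.
Hypothesis OmegaL : Omega `<=` cube L.
Local Notation innerO := (ip mu Omega).
Local Notation M := (fine (mu Omega)).

Let cs xi := cosd_sqint mOmega L0 OmegaL xi.
Let sn xi := sind_sqint mOmega L0 OmegaL xi.
Let Oo := Omega_finite mOmega L0 OmegaL.

Variable k : nat.
Variable u : 'I_k -> E -> R.
Hypothesis su : forall j, sqint mu Omega (u j).
Hypothesis ou : forall i j, innerO (u i) (u j) = (i == j)%:R.

Definition density (xi : E) : R := \sum_j power_spectrum Omega (u j) xi.

(** Bessel's inequality for the cosine and the sine of frequency [xi], whose
    squared norms add up to the measure of [Omega]. *)
Lemma density_le (xi : E) : 0 <= density xi <= M.
Proof.
apply/andP; split; first by apply: sumr_ge0 => j _; rewrite addr_ge0 ?sqr_ge0.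
have -> : M = innerO (cosd xi) (cosd xi) + innerO (sind xi) (sind xi).
  rewrite /ip -RintegralD//; [|exact: sqint_mul..].
  rewrite -[LHS]mul1r -(Rintegral_cst _ mOmega); apply: eq_Rintegral => x _.
  by rewrite -!expr2 cos2Dsin2.
rewrite /density big_split /=; apply: lerD; exact: (ip_bessel mOmega su).
Qed.

(** The coefficients at [xi'] against the orthonormal family differ from those
    at [xi] by the coefficients of a function of small norm. *)
Lemma density_slow (xi xi' : E) (eta : R) : 0 <= eta ->
  (forall x, Omega x -> `|dot x xi - dot x xi'| <= eta) ->
  density xi <= 2 * density xi' + 4 * eta ^+ 2 * M.
Proof.
move=> eta0 hx.
pose dc x := cosd xi x - cosd xi' x; pose ds x := sind xi x - sind xi' x.
have sdc : sqint mu Omega dc by exact: (sqintB mOmega (cs xi) (cs xi')).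
have sds : sqint mu Omega ds by exact: (sqintB mOmega (sn xi) (sn xi')).
have small f : sqint mu Omega f -> (forall x, Omega x -> `|f x| <= eta) ->
    \sum_j innerO (u j) f ^+ 2 <= eta ^+ 2 * M.
  move=> sf feta; apply: (le_trans (ip_bessel mOmega su sf ou)).
  rewrite -(Rintegral_cst _ mOmega); apply: le_Rintegral => //.
  - exact: sqint_mul.
  - apply: (bounded_fun_integrable mOmega Oo (f := fun=> eta ^+ 2) (C := eta ^+ 2)) => // x _.
    by rewrite ger0_norm// sqr_ge0.
  - move=> x Ox; rewrite -expr2 -real_normK ?num_real// lerXn2r ?nnegrE//.
    exact: feta.
have c1 := small dc sdc (fun x Ox => le_trans (cos_lipschitz _ _) (hx x Ox)).
have c2 := small ds sds (fun x Ox => le_trans (sin_lipschitz _ _) (hx x Ox)).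
apply: (@le_trans _ _ (2 * density xi' +
    2 * (\sum_j innerO (u j) dc ^+ 2 + \sum_j innerO (u j) ds ^+ 2))); last by lra.
rewrite /density -big_split /= !mulr_sumr -big_split /=; apply: ler_sum => j _.
rewrite /power_spectrum.
have -> : innerO (u j) dc = innerO (u j) (cosd xi) - innerO (u j) (cosd xi').
  by rewrite !(ipC _ _ (u j)) (ipBl mOmega (cs xi) (cs xi') (su j)).
have -> : innerO (u j) ds = innerO (u j) (sind xi) - innerO (u j) (sind xi').
  by rewrite !(ipC _ _ (u j)) (ipBl mOmega (sn xi) (sn xi') (su j)).
set a := innerO _ _; set b := innerO _ _; set a' := innerO _ _; set b' := innerO _ _.
have := sqr_ge0 (a - 2 * a'); have := sqr_ge0 (b - 2 * b'); nra.
Qed.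

End spectral_density.

(** * Comparison with the semiclassical count *)

Lemma infinitely_many_increasing (P : nat -> Prop) : (forall K, exists2 j, (K <= j)%N & P j) ->
  exists k : nat -> nat, {homo k : i j / (i < j)%N} /\ forall j, P (k j).
Proof.
move=> h.
have /choice[f fP] : forall K, exists j, (K <= j)%N /\ P j by move=> K; have [j] := h K; exists j.
exists (fix k j := if j is j'.+1 then f (k j').+1 else f 0); split.
  apply: homo_ltn => [y x z|j]; first exact: ltn_trans.
  exact: (fP _).1.
by case=> [|j]; exact: (fP _).2.
Qed.

Section asymptotics.
Context (R : realType) (n : nat).
Local Notation E := 'rV[R]_n.
Local Notation mu := (@lebesgue_rV R n).
Hypothesis n3 : (3 <= n)%N.
Variables (Omega : set E) (lambda : nat -> R).
Hypothesis Omega_open : open Omega.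
Hypothesis Omega_bounded : bounded_set Omega.
Hypothesis Omega_nonempty : Omega !=set0.
Hypothesis hlambda : dirichlet_eigenvalues Omega lambda.

Local Notation M := (fine (mu Omega)).
Local Notation om := (@omega R n).

Let n0 : (0 < n)%N. Proof. exact: leq_trans n3. Qed.
Let mOmega : measurable Omega. Proof. exact: rV_open_measurable. Qed.

Let M0 : 0 < M.
Proof.
apply: fine_gt0; apply/andP; split; first exact: open_lebesgue_rV_gt0.
exact: bounded_finite.
Qed.

(** Weyl's constant; [weyl_radius j] is the radius of the ball of frequencies
    for which the semiclassical eigenvalue count equals [j]. *)
Definition weyl : R := M * om / (2 * pi) ^+ n.
Definition weyl_radius (j : nat) : R := (j%:R / weyl) `^ n%:R^-1.
Local Notation r := weyl_radius.

Let pi20 : 0 < (2 * pi) ^+ n :> R. Proof. by rewrite exprn_gt0// mulr_gt0// pi_gt0. Qed.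

Lemma weyl_gt0 : 0 < weyl.
Proof. by rewrite divr_gt0// mulr_gt0// omega_gt0. Qed.

Lemma weyl_radius_ge0 j : 0 <= r j. Proof. exact: powR_ge0. Qed.

Lemma weyl_radiusX j : r j ^+ n = j%:R / weyl.
Proof.
rewrite -powR_mulrn ?powR_ge0// -powRrM mulVf ?pnatr_eq0 ?gtn_eqF// powRr1//.
by rewrite divr_ge0// ltW// weyl_gt0.
Qed.

Lemma weyl_radius0 : r 0 = 0.
Proof. by rewrite /weyl_radius mul0r powR0// invr_eq0 pnatr_eq0 gtn_eqF. Qed.

Lemma weyl_radius_lt i j : (i < j)%N -> r i < r j.
Proof.
move=> ij; rewrite -(@ltr_pXn2r _ n) ?nnegrE ?weyl_radius_ge0// !weyl_radiusX.
by rewrite ltr_pM2r ?ltr_nat// invr_gt0 weyl_gt0.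
Qed.

Lemma weyl_radius_unbounded (t : R) : exists k : nat, t <= r k.
Proof.
have [t0|t0] := leP t 0; first by exists 0; exact: le_trans (weyl_radius_ge0 _).
exists (Num.truncn (weyl * t ^+ n)).+1.
rewrite -(@ler_pXn2r _ n) ?nnegrE ?weyl_radius_ge0 ?(ltW t0)// weyl_radiusX.
by rewrite ler_pdivlMr ?weyl_gt0// mulrC; apply/ltW; exact: truncnS_gt.
Qed.

Lemma eigenvalue_lt_weyl_radius j : weyl * lambda j `^ (n%:R / 2) < j.+1%:R ->
  lambda j < r j.+1 ^+ 2.
Proof.
move=> h; rewrite ltNge; apply/negP => rl; move: h; rewrite ltNge => /negP; apply.
have r0 : 0 <= r j.+1 := weyl_radius_ge0 _.
have <- : weyl * r j.+1 ^+ n = j.+1%:R.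
  by rewrite weyl_radiusX mulrC divfK// gt_eqF// weyl_gt0.
rewrite ler_pM2l ?weyl_gt0// -powR_mulrn//.
have -> : r j.+1 `^ n%:R = (r j.+1 ^+ 2) `^ (n%:R / 2).
  by rewrite -(powR_mulrn 2 r0) -powRrM mulrC divfK.
apply: ge0_ler_powR; rewrite ?nnegrE ?divr_ge0// ?sqr_ge0//.
exact: le_trans (sqr_ge0 _) rl.
Qed.

(** Summation by parts. *)
Lemma weyl_layers k : \sum_(j < k) (r j.+1 ^+ 2 - r j ^+ 2) * j.+1%:R =
  k%:R * r k ^+ 2 - \sum_(j < k) r j.+1 ^+ 2 + r k ^+ 2.
Proof.
elim: k => [|k IH]; first by rewrite !big_ord0 mul0r weyl_radius0; ring.
rewrite big_ord_recr /= IH big_ord_recr /= -!(@natr1 _ k); ring.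
Qed.

(** The Berezin-Li-Yau bound with the bathtub gain, of order [r k ^+ n],
    deducted. The constants do not depend on [k]: the scale [delta] on which
    the density varies depends only on the size of [Omega]. *)
Lemma melas_gain : exists c r0 : R, [/\ 0 < c, 0 < r0 & forall k, r0 <= r k ->
  (2 * pi) ^+ n * \sum_(j < k) (r k ^+ 2 - lambda j) + c * r k ^+ n <=
  (2 * pi) ^+ n * \sum_(j < k) (r j.+1 ^+ 2 - r j ^+ 2) * j.+1%:R].
Proof.
have [L L0 OmegaL] := bounded_sub_cube Omega_bounded.
have [u [g [ug ou]]] := orthonormal_eigenfunctions Omega_open L0 OmegaL hlambda.
have [kappa /andP[kappa0 kappa2] kappaP] := sin_norm_ge R.
(* dilating by the factor of [bathtub_gain] moves the phases by at most 1 / 3 *)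
pose delta : R := (18 * n%:R * L)^-1.
have nR : 0 < n%:R :> R by rewrite ltr0n.
have delta0 : 0 < delta by rewrite invr_gt0 !mulr_gt0.
have deltaE : 6 * delta * (n%:R * L) = 3^-1.
  by rewrite /delta; field; rewrite !gt_eqF.
pose c := delta ^+ 2 * (M / 8) * om / 2 ^+ n.-1.
have om0 := @omega_gt0 R n.
exists c, (4 * delta); split.
- by rewrite /c divr_gt0// ?exprn_gt0// mulr_gt0// mulr_gt0 ?exprn_gt0// divr_gt0.
- by rewrite mulr_gt0.
move=> k rk; set z := r k ^+ 2.
have r0 : 0 < r k by apply: lt_le_trans rk; rewrite mulr_gt0.
(* large enough for both [z <= kappa^2 rho^2] and [4 r k <= rho] *)
pose rho := 2 * r k / kappa.
have rho0 : 0 < rho by rewrite divr_gt0// mulr_gt0.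
have z0 : 0 <= z by exact: sqr_ge0.
have krho : kappa * rho = 2 * r k by rewrite /rho mulrC divfK// gt_eqF.
have zrho : z <= kappa ^+ 2 * rho ^+ 2.
  by rewrite -exprMn krho /z exprMn ler_peMl ?sqr_ge0// -natrX ler1n.
have rrho : 4 * r k <= rho.
  rewrite /rho ler_pdivlMr// (_ : 4 * r k * kappa = 2 * r k * (2 * kappa)); last by ring.
  apply: ler_piMr; first by rewrite mulr_ge0// ltW.
  by rewrite -ler_pdivlMl// mulr1.
have su j : sqint mu Omega (u j) := H10_sqint Omega_open (ug j).1.
have energy j : (2 * pi) ^+ n * (z - lambda j) <=
    \int[mu]_(xi in [set xi : E | sqnorm xi < rho ^+ 2]) ((z - sqnorm xi) * power_spectrum Omega (u j) xi).
  have := sobolev_energy mOmega L0 OmegaL kappa0 kappaP z0 rho0 zrho (ug j).1.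
  by rewrite ((ug j).2 _ _ (ug j).1) ou eqxx !mulr1.
pose F := density Omega (fun j : 'I_k => u j).
have ou' (i j : 'I_k) : ip mu Omega (u i) (u j) = (i == j)%:R by rewrite ou.
have FM xi : 0 <= F xi <= M.
  exact: (density_le mOmega L0 OmegaL (fun j : 'I_k => su j) ou').
have mps j : measurable_fun setT (power_spectrum Omega (u j)).
  exact: (measurable_power_spectrum mOmega L0 OmegaL (ug j).1).
have mF : measurable_fun setT F by apply: measurable_sum => j; exact: mps.
have slow (x : E) : (r k - 2 * delta) ^+ 2 <= sqnorm x < (r k - delta) ^+ 2 ->
    M / 4 <= M - F x + F (((r k + delta) / (r k - 2 * delta)) *: x).
  move=> /andP[_ xr]; set s := (r k + delta) / _.
  have r2d : 0 < r k - 2 * delta by move: rk delta0; lra.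
  have rd : 0 <= r k - delta by move: rk delta0; lra.
  have sE : s - 1 = 3 * delta / (r k - 2 * delta) by rewrite /s; field; rewrite gt_eqF.
  have s10 : 0 <= s - 1 by rewrite sE divr_ge0// ?mulr_ge0// ltW.
  have hx (y : E) : Omega y -> `|dot y x - dot y (s *: x)| <= 3^-1.
    move=> /OmegaL/cubeP yL.
    have -> : dot y x - dot y (s *: x) = - (s - 1) * dot y x.
      have -> : dot y (s *: x) = s * dot y x.
        by rewrite /dot mulr_sumr; apply: eq_bigr => i _; rewrite mxE mulrCA.
      by ring.
    rewrite normrM normrN (ger0_norm s10).
    have dL : `|dot y x| <= n%:R * (L * (r k - delta)).
      apply: (le_trans (ler_norm_sum _ _ _)).
      apply: (@le_trans _ _ (\sum_(i < n) L * (r k - delta))).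
        apply: ler_sum => i _; rewrite normrM; apply: ler_pM => //.
        by have /sqnorm_lt_cube/cubeP/(_ i) := xr; rewrite (ger0_norm rd).
      by rewrite sumr_const card_ord mulr_natl.
    apply: (le_trans (ler_wpM2l s10 dL)); rewrite -deltaE sE.
    rewrite [leLHS](_ : _ = (3 * delta * (n%:R * L)) * ((r k - delta) / (r k - 2 * delta))); last by ring.
    rewrite [leRHS](_ : _ = (3 * delta * (n%:R * L)) * 2); last by ring.
    apply: ler_wpM2l; first by rewrite !mulr_ge0// ltW.
    by rewrite ler_pdivrMr//; move: rk delta0; lra.
  have third : 0 <= 3^-1 :> R by rewrite invr_ge0.
  have := density_slow mOmega L0 OmegaL (fun j : 'I_k => su j) ou' third hx.
  rewrite -/F; have /andP[_] := FM x; have := M0; have /andP[+ _] := FM (s *: x).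
  move: (F x) (F (s *: x)) => a b.
  rewrite exprVn; set m := fine _.
  by move=> b0 m0 am ab; lra.
have gain := bathtub_gain n0 mF M0 FM delta0 rk rrho slow.
have ips (j : 'I_k) : mu.-integrable [set xi : E | sqnorm xi < rho ^+ 2]
    (EFin \o (fun xi : E => (z - sqnorm xi) * power_spectrum Omega (u j) xi)).
  apply: (@bounded_fun_integrable _ _ _ mu _ (@measurable_sqnorm_lt R n _) (ball_finite n rho)
      _ ((z + rho ^+ 2) * (2 * (1 * M)))).
    apply: measurable_funTS; apply: measurable_funM => //.
    by apply: measurable_funB => //; exact: measurable_sqnorm.
  move=> x /= xr; rewrite normrM; have x0 := sqnorm_ge0 x; apply: ler_pM => //.
    rewrite ler_norml; move: z0 x0 xr; move: (rho ^+ 2) => q z0' x0 xr.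
    by apply/andP; split; lra.
  have /andP[p0 p1] := power_spectrum_le mOmega L0 OmegaL x (su j).
  by rewrite ger0_norm//; move: p1; rewrite ou eqxx.
have int_sum : \int[mu]_(xi in [set xi : E | sqnorm xi < rho ^+ 2]) ((z - sqnorm xi) * F xi) =
    \sum_(j < k) \int[mu]_(xi in [set xi : E | sqnorm xi < rho ^+ 2])
      ((z - sqnorm xi) * power_spectrum Omega (u j) xi).
  rewrite -(Rintegral_sum (@measurable_sqnorm_lt R n _) _ ips).
  by apply: eq_Rintegral => x _; rewrite /F /density mulr_sumr.
have layers := Rintegral_ball_layers n0 k weyl_radius_ge0 (fun j => ltW (weyl_radius_lt (ltnSn j))).
have E1 : (2 * pi) ^+ n * \sum_(j < k) (z - lambda j) <=
    \int[mu]_(xi in [set xi : E | sqnorm xi < rho ^+ 2]) ((z - sqnorm xi) * F xi).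
  by rewrite int_sum mulr_sumr; apply: ler_sum => j _; exact: energy.
have E2 : r k * delta * (M / 8) * (delta * (r k / 2) ^+ n.-1 * om) = c * r k ^+ n.
  have -> : r k ^+ n = r k * r k ^+ n.-1 by rewrite -exprS prednK.
  by rewrite /c exprMn exprVn; field; rewrite expf_neq0.
have E3 : M * (\sum_(j < k) (r j.+1 ^+ 2 - r j ^+ 2) * (r j.+1 ^+ n * om) + r 0 ^+ 2 * (r 0 ^+ n * om)) =
    (2 * pi) ^+ n * \sum_(j < k) (r j.+1 ^+ 2 - r j ^+ 2) * j.+1%:R.
  rewrite weyl_radius0 [0 ^+ 2]expr0n mul0r addr0 !mulr_sumr; apply: eq_bigr => j _.
  rewrite weyl_radiusX /weyl; field.
  by rewrite !gt_eqF.
rewrite -E3; apply: le_trans (ler_wpM2l (ltW M0) layers); apply: le_trans gain.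
by rewrite E2 lerD2r.
Qed.

End asymptotics.

(* [lambda k] is the eigenvalue of rank k + 1. *)
Theorem corollary1p2 (R : realType) (n : nat) (hn : (3 <= n)%N)
    (Omega : set 'rV[R]_n) (Omega_open : open Omega)
    (Omega_bounded : bounded_set Omega) (Omega_nonempty : Omega !=set0)
    (lambda : nat -> R) (hlambda : dirichlet_eigenvalues Omega lambda) :
  exists k : nat -> nat,
    {homo k : i j / (i < j)%N} /\
    forall j : nat,
      fine (lebesgue_rV n Omega) * fine (lebesgue_rV n (@unit_ball R n))
        / (2 * pi) ^+ n * lambda (k j) `^ (n%:R / 2) >= (k j).+1%:R.
Proof.
apply: (@infinitely_many_increasing
  (fun j => j.+1%:R <= weyl Omega * lambda j `^ (n%:R / 2))) => K.
apply: contrapT => noK.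
pose r := weyl_radius Omega.
have small j : (K <= j)%N -> lambda j < r j.+1 ^+ 2.
  move=> Kj; apply: eigenvalue_lt_weyl_radius => //.
  by rewrite ltNge; apply/negP => h; apply: noK; exists j.
have [c [r0 [c0 r00 gain]]] := melas_gain hn Omega_open Omega_bounded Omega_nonempty hlambda.
pose a : R := \sum_(j < K) `|lambda j|.
have a0 : 0 <= a by exact: sumr_ge0.
have sum_small k : (K <= k)%N -> \sum_(j < k) lambda j <= \sum_(j < k) r j.+1 ^+ 2 + a.
  move=> Kk; rewrite /a (big_ord_widen k (fun j => `|lambda j|) Kk) [X in _ + X]big_mkcond -big_split /=.
  apply: ler_sum => j _; case: ltnP => jK; last by rewrite addr0 ltW// small.
  by rewrite (le_trans (ler_norm _))// lerDr sqr_ge0.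
have C20 : 0 < (2 * pi) ^+ n :> R by rewrite exprn_gt0// mulr_gt0// pi_gt0.
set C2 := (2 * pi) ^+ n in C20 gain.
pose t := Num.max 1 (Num.max r0 (C2 * (1 + a) / c + 1)).
have [k0 k0P] := weyl_radius_unbounded hn Omega_open Omega_bounded Omega_nonempty t.
pose k := maxn k0 K.
have rk : t <= r k.
  apply: (le_trans k0P); have := leq_maxl k0 K; rewrite leq_eqVlt => /predU1P[{1}->//|].
  by move=> /(weyl_radius_lt hn Omega_open Omega_bounded Omega_nonempty)/ltW.
have r1 : 1 <= r k by apply: le_trans rk; rewrite le_max lexx.
have rk0 : r0 <= r k by apply: le_trans rk; rewrite !le_max lexx orbT.
have rkc : C2 * (1 + a) / c + 1 <= r k by apply: le_trans rk; rewrite !le_max lexx !orbT.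
have := gain k rk0; rewrite (weyl_layers hn) -/r sumrB sumr_const card_ord -[_ *+ k]mulr_natl.
have := sum_small k (leq_maxr _ _).
set S := \sum_(j < k) r j.+1 ^+ 2; set Lam := \sum_(j < k) lambda j => LS hg.
have h1 : c * r k ^+ n <= C2 * (r k ^+ 2 + a).
  have : C2 * Lam <= C2 * (S + a) by rewrite ler_pM2l.
  by move: hg; rewrite -/r; set x := k%:R * _; set y := r k ^+ 2; lra.
have r3 : r k ^+ 3 <= r k ^+ n by rewrite ler_weXn2l.
have h2 : C2 * (1 + a) < c * r k.
  have : C2 * (1 + a) / c < r k by apply: lt_le_trans rkc; rewrite ltrDl.
  by rewrite ltr_pdivrMr// [ltRHS]mulrC.
have h3 : C2 * (1 + a) * r k ^+ 2 < c * r k ^+ 3.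
  by rewrite (exprS _ 2) mulrA ltr_pM2r// exprn_gt0// (lt_le_trans _ r1).
have h4 : C2 * (r k ^+ 2 + a) <= C2 * (1 + a) * r k ^+ 2.
  by rewrite -mulrA ler_pM2l// mulrDl mul1r lerD2l ler_peMr// exprn_ege1.
have h5 : c * r k ^+ 3 <= c * r k ^+ n by rewrite ler_pM2l.
by move: (lt_le_trans h3 (le_trans h5 (le_trans h1 h4))); rewrite ltxx.
Qed.
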